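(* Let $N\ge 2$, $A\ge 0$ and $m\in(0,\infty)$. Let $K$ be a kernel on $\mathbb{R}^N$ such that $K(x)\ge 0$ and $K(-x)=K(x)$ for all $x$, $K\in L^1(B_1^c(0))$, $K$ is locally Lipschitz in $\mathbb{R}^N\setminus\{0\}$, and there exist constants $0<s<1$, $\varepsilon>2^{\frac{1}{N+s-1}}-1>0$ and $\lambda>1$ such that $|x|^{-(N+s)}\le K(x)\le \lambda|x|^{-(N+s)}$ for all $0<|x|<1+\varepsilon$ and $|x|^{-(N+s)}\le K(x)\le (1+\varepsilon)^{-(N+s)}$ for all $|x|\ge 1+\varepsilon$. Then every minimizer $E$ of $\mathcal{F}_{(K,A)}$ among measurable subsets of $\mathbb{R}^N$ with Lebesgue measure $m$ is bounded (up to a Lebesgue null set), i.e. there exists $r>0$ with $|E\setminus B_r(0)|=0$.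
   Context: For measurable $E\subset\mathbb{R}^N$, $|E|$ denotes Lebesgue measure, $E^c=\mathbb{R}^N\setminus E$, $B_r(x)$ is the open ball of radius $r$ centred at $x$, and $B_1^c(0)=\mathbb{R}^N\setminus B_1(0)$. Define $$P_K(E)=\int_E\int_{E^c}K(x-y)\,dx\,dy,\qquad V_1(E)=\frac12\int_E\int_E\frac{1}{|x-y|}\,dx\,dy,\qquad R(E)=\int_E\frac{1}{|x|}\,dx,$$ and $\mathcal{F}_{(K,A)}(E)=P_K(E)+V_1(E)-A\,R(E)$. A minimizer is a measurable set $E$ with $|E|=m$ and $\mathcal{F}_{(K,A)}(E)\le \mathcal{F}_{(K,A)}(E')$ for all measurable $E'$ with $|E'|=m$. Sets differing by a Lebesgue null set are identified. *)

(* Defs.v *)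
From HB Require Import structures.
From mathcomp Require Import all_boot all_order all_algebra.
From mathcomp Require Import all_classical all_reals all_analysis.

Set Implicit Arguments.
Unset Strict Implicit.
Unset Printing Implicit Defensive.

Import Order.TTheory GRing.Theory Num.Theory.
Import numFieldNormedType.Exports.

Local Open Scope classical_set_scope.
Local Open Scope ring_scope.

(* The product Borel sigma-algebra on row vectors, as the library does for
   tuples. *)
Section rV_measurable.
Context {R : realType} (n : nat).

Let coord (i : 'I_n) (x : 'rV[R]_n) : R := x ord0 i.

Let rV_set0 : g_sigma_preimage coord set0.
Proof. exact: sigma_algebra0. Qed.

Let rV_setC A : g_sigma_preimage coord A -> g_sigma_preimage coord (~` A).
Proof. exact: sigma_algebraC. Qed.

Let rV_bigcup (F : (set 'rV[R]_n)^nat) :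
  (forall i, g_sigma_preimage coord (F i)) ->
  g_sigma_preimage coord (\bigcup_i (F i)).
Proof. exact: sigma_algebra_bigcup. Qed.

HB.instance Definition _ :=
  @isMeasurable.Build (measure_tuple_display default_measure_display)
    'rV[R]_n (g_sigma_preimage coord) rV_set0 rV_setC rV_bigcup.

End rV_measurable.

Section rV_cons.
Context {R : realType} (n : nat).

Lemma measurable_coord (i : 'I_n) :
  measurable_fun [set: 'rV[R]_n] (fun x : 'rV[R]_n => x ord0 i).
Proof.
move=> _ Y mY; rewrite setTI; apply: sub_sigma_algebra => /=.
rewrite -bigcup_seq/=; exists i => /=; first by rewrite mem_index_enum.
by exists Y => //; rewrite setTI.
Qed.

Lemma measurable_fun_rVP d (T : measurableType d) (f : T -> 'rV[R]_n) :
  (forall i, measurable_fun [set: T] (fun t => f t ord0 i)) ->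
  measurable_fun [set: T] f.
Proof.
move=> mf; apply: (@measurability _ _ _ _ _ f
  (\big[setU/set0]_(i < n) preimage_set_system setT
     (fun x : 'rV[R]_n => x ord0 i) measurable)) => //.
move=> _ [A + <-]; rewrite -bigcup_seq/= => -[i _] [B mB <-].
by rewrite !setTI -[X in measurable X]setTI; exact: (mf i).
Qed.

End rV_cons.

Section lebesgue_rV.
Context {R : realType}.
Local Open Scope ereal_scope.

Definition rV_cons n (p : R * 'rV[R]_n) : 'rV[R]_n.+1 :=
  \row_i if unlift ord0 i is Some j then p.2 ord0 j else p.1.

Definition rV_uncons n (x : 'rV[R]_n.+1) : R * 'rV[R]_n :=
  (x ord0 ord0, \row_i x ord0 (lift ord0 i)).

Lemma rV_cons0 n (p : R * 'rV[R]_n) : rV_cons p ord0 ord0 = p.1.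
Proof. by rewrite mxE unlift_none. Qed.

Lemma rV_consS n (p : R * 'rV[R]_n) i :
  rV_cons p ord0 (lift ord0 i) = p.2 ord0 i.
Proof. by rewrite mxE liftK. Qed.

Lemma rV_consK n : cancel (@rV_cons n) (@rV_uncons n).
Proof.
move=> [a v]; rewrite /rV_uncons rV_cons0/=; congr pair.
by apply/rowP => i; rewrite mxE rV_consS.
Qed.

Lemma rV_unconsK n : cancel (@rV_uncons n) (@rV_cons n).
Proof.
move=> x; apply/rowP => i; case: (unliftP ord0 i) => [j ->|->].
  by rewrite rV_consS mxE.
by rewrite rV_cons0.
Qed.

Lemma measurable_rV_cons n : measurable_fun setT (@rV_cons n).
Proof.
apply: measurable_fun_rVP => i; case: (unliftP ord0 i) => [j ->|->].
- rewrite (_ : (fun _ => _) = (fun v : 'rV[R]_n => v ord0 j) \o snd); last first.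
    by apply/funext => p; rewrite rV_consS.
  exact: (measurableT_comp (measurable_coord j)).
- rewrite (_ : (fun _ => _) = fst); first exact: measurable_fst.
  by apply/funext => p; rewrite rV_cons0.
Qed.

Lemma measurable_rV_uncons n : measurable_fun setT (@rV_uncons n).
Proof.
apply/measurable_fun_pairP; split; first exact: measurable_coord.
apply: measurable_fun_rVP => i.
rewrite (_ : (fun _ => _) = (fun x : 'rV[R]_n.+1 => x ord0 (lift ord0 i))).
  exact: measurable_coord.
by apply/funext => x; rewrite mxE.
Qed.

Section step.
Context (n : nat) (mu : {sigma_finite_measure set 'rV[R]_n -> \bar R}).

Definition rV_measureS : set 'rV[R]_n.+1 -> \bar R :=
  pushforward (@lebesgue_measure R \x mu) (@rV_cons n).

Let rV_measureS0 : rV_measureS set0 = 0.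
Proof. by rewrite /rV_measureS /pushforward preimage_set0 measure0. Qed.

Let rV_measureS_ge0 A : 0 <= rV_measureS A.
Proof. by rewrite /rV_measureS /pushforward; exact: measure_ge0. Qed.

Let rV_measureS_sigma_additive : semi_sigma_additive rV_measureS.
Proof.
move=> F mF tF mUF; rewrite /rV_measureS /pushforward preimage_bigcup.
have mcons A : measurable A -> measurable (@rV_cons n @^-1` A).
  by move=> mA; rewrite -[X in measurable X]setTI; exact: measurable_rV_cons.
apply: measure_semi_sigma_additive.
- by move=> k; exact: mcons.
- apply/trivIsetP => i j _ _ ij; rewrite -preimage_setI.
  by move/trivIsetP : tF => /(_ _ _ _ _ ij) ->//; rewrite preimage_set0.
- by rewrite -preimage_bigcup; exact: mcons.
Qed.

HB.instance Definition _ := isMeasure.Build _ _ _ rV_measureS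
  rV_measureS0 rV_measureS_ge0 rV_measureS_sigma_additive.

Let rV_measureS_sigma_finite : sigma_finite setT rV_measureS.
Proof.
have /sigma_finiteP[F [TF ndF Foo]] := sigma_finiteT (@lebesgue_measure R).
have /sigma_finiteP[G [TG ndG Goo]] := sigma_finiteT mu.
have FGT : \bigcup_k (F k `*` G k) = setT.
  apply/seteqP; split=> // -[x y] _.
  have [i _ Fix] : (\bigcup_k F k) x by rewrite -TF.
  have [j _ Gjy] : (\bigcup_k G k) y by rewrite -TG.
  exists (maxn i j) => //; split => /=.
  - by move: x Fix; exact/subsetPset/ndF/leq_maxl.
  - by move: y Gjy; exact/subsetPset/ndG/leq_maxr.
exists (fun k => @rV_uncons n @^-1` (F k `*` G k)).
  by rewrite -preimage_bigcup FGT preimage_setT.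
move=> k; have [mF Fk] := Foo k; have [mG Gk] := Goo k; split.
  rewrite -[X in measurable X]setTI; apply: measurable_rV_uncons => //.
  exact: measurableX.
rewrite /rV_measureS /pushforward -comp_preimage.
rewrite (_ : @rV_uncons n \o @rV_cons n = id) ?preimage_id; last first.
  by apply/funext => p /=; rewrite rV_consK.
by rewrite product_measure1E// lte_mul_pinfty// ge0_fin_numE.
Qed.

HB.instance Definition _ := Measure_isSigmaFinite.Build _ _ _ rV_measureS
  rV_measureS_sigma_finite.

End step.

Fixpoint borel_lebesgue n : {sigma_finite_measure set 'rV[R]_n -> \bar R} :=
  if n is k.+1 then [the {sigma_finite_measure set _ -> \bar R} of
    rV_measureS (borel_lebesgue k)]
  else [the {sigma_finite_measure set _ -> \bar R} of \d_(0%R : 'rV[R]_0)].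

End lebesgue_rV.

Lemma borel_lebesgue_box (R : realType) n (a b : 'rV[R]_n) :
  (forall i, a ord0 i <= b ord0 i) ->
  borel_lebesgue n [set x | forall i, x ord0 i \in `[a ord0 i, b ord0 i]] =
  (\prod_(i < n) (b ord0 i - a ord0 i))%:E.
Proof.
elim: n a b => [|n IH] a b ab.
  rewrite big_ord0 [X in borel_lebesgue _ X](_ : _ = setT) /= ?diracT//.
  by apply/seteqP; split => // x _ [].
rewrite big_ord_recl EFinM.
have := IH (\row_i a ord0 (lift ord0 i)) (\row_i b ord0 (lift ord0 i)).
under eq_bigr do rewrite !mxE.
move=> <-; last by move=> i; rewrite !mxE.
have -> : ((b ord0 ord0 - a ord0 ord0)%:E =
    lebesgue_measure `[a ord0 ord0, b ord0 ord0]%classic)%E.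
  rewrite lebesgue_measure_itv/= lte_fin; case: ltP => [//|ba].
  by rewrite (@le_anti _ _ (a ord0 ord0) (b ord0 ord0)) ?subrr// ab.
rewrite -product_measure1E//=.
- rewrite /rV_measureS /pushforward; congr (_ _).
  apply/seteqP; split => -[x v] /=.
  + move=> xv; split; first by have := xv ord0; rewrite rV_cons0.
    by move=> i; have := xv (lift ord0 i); rewrite rV_consS !mxE.
  + move=> [x0 vS] i; case: (unliftP ord0 i) => [j ->|->].
      by have := vS j; rewrite rV_consS !mxE.
    by rewrite rV_cons0.
- rewrite [X in measurable X](_ : _ = \bigcap_(i in [set: 'I_n])
    ((fun x : 'rV[R]_n => x ord0 i) @^-1`
      `[(\row_i a ord0 (lift ord0 i)) ord0 i,
        (\row_i b ord0 (lift ord0 i)) ord0 i]%classic)).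
    apply: fin_bigcap_measurable => // i _.
    by rewrite -[X in measurable X]setTI; exact: measurable_coord.
  by apply/seteqP; split => x /= xab i => [_|]; exact: xab.
Qed.

Section lebesgue_completion.
Context {R : realType} (n : nat).

Definition lebesgue_rV : set _ -> \bar R :=
  @completed_measure_extension _ _ _ (borel_lebesgue n).

HB.instance Definition _ := Measure.on lebesgue_rV.

Let lebesgue_rV_sigma_finite : sigma_finite setT lebesgue_rV.
Proof.
exact/completed_measure_extension_sigma_finite/sigma_finiteT.
Qed.

HB.instance Definition _ := Measure_isSigmaFinite.Build _ _ _ lebesgue_rV
  lebesgue_rV_sigma_finite.

(* Lebesgue measurability, i.e. Caratheodory measurability with respect to
   the outer measure of borel_lebesgue. *)
Definition lebesgue_measurable : set (set 'rV[R]_n) :=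
  ((@borel_lebesgue R n)^*)%mu.-cara.-measurable.

End lebesgue_completion.
Arguments lebesgue_rV {R n}.
Arguments lebesgue_measurable {R n}.

(* The library's norm on 'rV[R]_n is the sup norm, and its balls are cubes;
   |x| and B_r(x) are Euclidean. *)
Definition enorm (R : realType) n (x : 'rV[R]_n) : R :=
  Num.sqrt (\sum_(i < n) x ord0 i ^+ 2).

Definition eball (R : realType) n (x : 'rV[R]_n) (r : R) : set 'rV[R]_n :=
  [set y | enorm (y - x) < r].

Section energy.
Context {R : realType} (n : nat).
Implicit Types (K : 'rV[R]_n -> R) (E : set 'rV[R]_n).
Local Open Scope ereal_scope.

Definition perimeter K E : \bar R :=
  \int[lebesgue_rV]_(y in E) \int[lebesgue_rV]_(x in ~` E) (K (x - y)%R)%:E.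

(* The inverse is that of extended reals, for which 0^-1 = +oo. *)
Definition coulomb E : \bar R :=
  (2^-1)%:E * \int[lebesgue_rV]_(y in E) \int[lebesgue_rV]_(x in E)
    (enorm (x - y)%R)%:E^-1.

Definition attraction E : \bar R :=
  \int[lebesgue_rV]_(x in E) (enorm (x : 'rV[R]_n))%:E^-1.

Definition energy K (A : R) E : \bar R :=
  perimeter K E + coulomb E - A%:E * attraction E.

Definition minimizer K (A m : R) E : Prop :=
  [/\ lebesgue_measurable E, lebesgue_rV E = m%:E &
      forall E', lebesgue_measurable E' -> lebesgue_rV E' = m%:E ->
        energy K A E <= energy K A E'].

End energy.

(* Main.v *)
(** Let [e(v)] be the infimum of the energy at volume [v].  Submodularity of the
    nonlocal perimeter, applied to [F] and a translate [F - w], gives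
    [P(F `|` (F - w)) + P(F `&` (F - w)) <= 2 P(F)].  The two sets on the left
    have volumes [|F| + d] and [|F| - d], where [d := |F `\` (F - w)|] can be
    prescribed by choosing [w] of length [O(d)]; the Coulomb and attraction
    terms change by [O(d ^ b)] for any [b < 1].  Hence [e] is concave up to
    [O(d ^ b)], and halving [d] repeatedly yields [e(m) <= e(m - d) + C d ^ b].

    Let now [E] be a minimizer and [f(r) := |E `\` B_r|].  Discarding
    [E `\` B_r] gains [c f(r) ^ (1 - s / N)] by an isoperimetric inequality, up
    to the interaction of the two pieces of [E], whose mean over [r] in
    [[a, a + l]] is at most [kappa f(a) / l] because [K(z) min(|z|, 1)] is
    integrable.  Taking [1 - s / N < b < 1], comparison with the previous bound
    gives [f(a + l) ^ (1 - s / N) <= C f(a) / l] once [f(a)] is small, and a De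
    Giorgi iteration makes [f] vanish at a finite radius. *)

From HB Require Import structures.
Require Import Defs.
From mathcomp Require Import all_boot all_order all_algebra.
From mathcomp Require Import all_classical all_reals all_analysis.
From mathcomp Require Import measurable_realfun ring lra.
Set Implicit Arguments.
Unset Strict Implicit.
Unset Printing Implicit Defensive.
Import Order.TTheory GRing.Theory Num.Theory.
Import numFieldNormedType.Exports.
Local Open Scope classical_set_scope.
Local Open Scope ring_scope.

(** * Borel and completed Lebesgue measure on row vectors *)

(** [K] need not be homogeneous, so dilating a set to restore lost volume has no simple effect on
    the energy. A translation leaves the perimeter and the Coulomb term invariant and perturbs the
    attraction alone, which is why volume is traded between a union and an intersection of
    translates.

    The window [1 - s / N < b < 1] has two sides. From below, [d ^ b] must be negligible against the
    isoperimetric gain [d ^ (1 - s / N)] for small [d]. From above, moving a set by [w] costs at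
    most [|w| ^ b |x| ^ -(1 + b)] in [1 / |x|], whose singularity is integrable in every dimension
    [N >= 2] only if [b < 1]; the halving recursion also closes only because [2 ^ b < 2].

    Exchanging integrals relies on Tonelli, hence on the Borel measure [borel_lebesgue]. A minimizer
    is only Lebesgue measurable, so it is replaced by a Borel hull of the same volume and the same
    energy. *)

Lemma lebesgue_measure_shift (R : realType) (w : R) (A : set R) :
  measurable A ->
  lebesgue_measure ((fun x : measurableTypeR R => x + w) @^-1` A) =
  lebesgue_measure A.
Proof.
move=> mA.
rewrite -[LHS]/(pushforward lebesgue_measure ((fun x => x + w) : _ -> measurableTypeR R) A).
apply/esym/lebesgue_measure_unique => //=.
  exact: measurable_funD.
move=> mw _ [[a b]] _ <-.
rewrite /pushforward/=.
rewrite (_ : _ @^-1` _ = [set` `]a - w, b - w]]); last first.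
  by apply/seteqP; split => x /=; rewrite !in_itv/= ltrBlDr lerBrDr.
rewrite !lebesgue_measure_itv/= !lte_fin ltrD2r.
by case: ifPn => // _; rewrite -!EFinB; congr EFin; ring.
Qed.

Notation leb N := (@borel_lebesgue _ N : {measure set _ -> \bar _}).

Section shift.
Context {R : realType}.
Local Open Scope ereal_scope.

Lemma measurable_fun_rVD d (T : measurableType d) N (f g : T -> 'rV[R]_N) :
  measurable_fun setT f -> measurable_fun setT g ->
  measurable_fun setT (fun x => f x + g x)%R.
Proof.
move=> mf mg; apply: measurable_fun_rVP => i.
rewrite (_ : (fun _ => _) = (fun t => f t ord0 i + g t ord0 i)%R); last first.
  by apply/funext => t; rewrite mxE.
by apply: measurable_funD; apply: (measurableT_comp (measurable_coord i)).
Qed.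

Lemma measurable_fun_rVZ d (T : measurableType d) N (c : R) (f : T -> 'rV[R]_N) :
  measurable_fun setT f -> measurable_fun setT (fun x => c *: f x)%R.
Proof.
move=> mf; apply: measurable_fun_rVP => i.
rewrite (_ : (fun _ => _) = (fun t => c * f t ord0 i)%R); last first.
  by apply/funext => t; rewrite mxE.
by apply: measurable_funM => //; apply: (measurableT_comp (measurable_coord i)).
Qed.

Lemma measurable_fun_rVB d (T : measurableType d) N (f g : T -> 'rV[R]_N) :
  measurable_fun setT f -> measurable_fun setT g ->
  measurable_fun setT (fun x => f x - g x)%R.
Proof.
move=> mf mg; under eq_fun do rewrite -scaleN1r.
by apply: measurable_fun_rVD => //; exact: measurable_fun_rVZ.
Qed.

Lemma measurable_rV_shift N (w : 'rV[R]_N) :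
  measurable_fun setT (fun x : 'rV[R]_N => x + w)%R.
Proof. by apply: measurable_fun_rVD => //; exact: measurable_cst. Qed.

(** Induction on the dimension, slicing along the first coordinate: the induction hypothesis
    translates each slice by the remaining coordinates, and invariance on the line translates the
    slicing variable. *)
Lemma borel_lebesgue_shift N (w : 'rV[R]_N) (A : set 'rV[R]_N) : measurable A ->
  leb N ((fun x => x + w)%R @^-1` A) = leb N A.
Proof.
elim: N w A => [|N IH] w A mA.
  rewrite (_ : _ @^-1` _ = A)//; apply/funext => x.
  by rewrite /preimage/=; congr A; apply/rowP => -[].
pose w0 := w ord0 ord0; pose w' := (rV_uncons w).2.
have mcons (B : set 'rV[R]_N.+1) : measurable B -> measurable (@rV_cons R N @^-1` B).
  by move=> mB; rewrite -[X in measurable X]setTI; exact: measurable_rV_cons.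
set B := @rV_cons R N @^-1` A.
have mB : measurable B by exact: mcons.
pose G (a : measurableTypeR R) := borel_lebesgue N (xsection B a).
have mG : measurable_fun setT G by exact: measurable_fun_xsection.
transitivity (\int[lebesgue_measure]_a G (a + w0)%R).
  rewrite /= /rV_measureS /pushforward /product_measure1.
  apply: eq_integral => a _ /=; rewrite /G.
  rewrite -(IH w' (xsection B (a + w0)%R)); last exact: measurable_xsection.
  congr (_ _); apply/seteqP; split => v /=; rewrite /xsection/= !inE /B/=.
  + congr A; apply/rowP => i; rewrite !mxE; case: (unliftP ord0 i) => [j|] -> //=.
    by rewrite !mxE.
  + congr A; apply/rowP => i; rewrite !mxE; case: (unliftP ord0 i) => [j|] -> //=.
    by rewrite !mxE.
have mw : measurable_fun setT (fun x : measurableTypeR R => x + w0)%R.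
  exact: measurable_funD.
have /esym := @ge0_integral_pushforward _ _ (measurableTypeR R)
  (measurableTypeR R) R _ mw lebesgue_measure setT G measurableT mG
  (fun _ _ => measure_ge0 _ _).
rewrite preimage_setT /comp => ->.
by apply: eq_measure_integral => C mC _; exact: lebesgue_measure_shift.
Qed.

Lemma ge0_integral_shift N (w : 'rV[R]_N) (f : 'rV[R]_N -> \bar R) :
  measurable_fun setT f -> (forall x, 0 <= f x) ->
  \int[leb N]_x f (x + w)%R = \int[leb N]_x f x.
Proof.
move=> mf f0.
have /esym := @ge0_integral_pushforward _ _ _ _ R _ (measurable_rV_shift w)
  (borel_lebesgue N) setT f measurableT mf (fun x _ => f0 x).
rewrite preimage_setT /comp => ->.
apply: eq_measure_integral => [|mS C mC _]; first exact: measurable_rV_shift.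
exact: borel_lebesgue_shift.
Qed.

End shift.

Section lebesgue_borel.
Context {R : realType} (N : nat).
Local Open Scope ereal_scope.
Local Notation T := 'rV[R]_N.
Local Notation mu := (@borel_lebesgue R N : {measure set T -> \bar R}).

Lemma lebesgue_measurable_borel (A : set T) : measurable A -> lebesgue_measurable A.
Proof. exact: caratheodory_measurable_mu_ext. Qed.

Lemma lebesgue_rV_borel (A : set T) : measurable A -> lebesgue_rV A = mu A.
Proof. by move=> mA; exact: measurable_mu_extE. Qed.

(** The identity is measurable from the completed space to the Borel one and pushes [lebesgue_rV]
    forward to [borel_lebesgue]. *)
Lemma ge0_integral_lebesgue_borel (f : T -> \bar R) :
  measurable_fun setT f -> (forall x, 0 <= f x) ->
  \int[lebesgue_rV]_x f x = \int[mu]_x f x.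
Proof.
move=> mf f0.
pose U := caratheodory_type ((@borel_lebesgue R N)^*)%mu.
have mid : measurable_fun setT (id : U -> T).
  move=> _ Y mY; rewrite setTI; exact: lebesgue_measurable_borel.
have /esym := @ge0_integral_pushforward _ _ U T R _ mid
  lebesgue_rV setT f measurableT mf (fun x _ => f0 x).
rewrite preimage_setT /comp => ->.
apply: eq_measure_integral => C mC _.
exact: lebesgue_rV_borel.
Qed.

(** [lebesgue_rV] is the outer measure given by countable Borel covers; covers optimal up to
    [1 / (k + 1)] are intersected over [k]. *)
Lemma borel_hull (E : set T) : (lebesgue_rV E < +oo) -> 
  exists2 B : set T, measurable B /\ E `<=` B & mu B = lebesgue_rV E.
Proof.
move=> Efin.
have E0 : lebesgue_rV E \is a fin_num by rewrite ge0_fin_numE// outer_measure_ge0.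
have cover k : exists B : set T, [/\ measurable B, E `<=` B &
    mu B <= lebesgue_rV E + (k.+1%:R^-1)%:E].
  have k0 : (0 < k.+1%:R^-1 :> R)%R by rewrite invr_gt0 ltr0n.
  have [_ [F [mF EF] <-] lF] := lb_ereal_inf_adherent k0 E0.
  exists (\bigcup_i F i); split => //; first exact: bigcupT_measurable.
  apply: le_trans (ltW lF).
  apply: measure_sigma_subadditive => //; exact: bigcupT_measurable.
pose B k := sval (cid (cover k)).
have mB k : measurable (B k) by rewrite /B; case: cid => ? [].
have EB k : E `<=` B k by rewrite /B; case: cid => ? [].
have lB k : mu (B k) <= lebesgue_rV E + (k.+1%:R^-1)%:E.
  by rewrite /B; case: cid => ? [].
have mC : measurable (\bigcap_k B k) by exact: bigcapT_measurable.
exists (\bigcap_k B k); first by split => // x Ex k _; exact: EB.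
apply/eqP; rewrite eq_le; apply/andP; split; last first.
  rewrite -lebesgue_rV_borel//; apply: le_outer_measure => x Ex k _; exact: EB.
apply/lee_addgt0Pr => e e0.
have [k ke] : exists k : nat, (k.+1%:R^-1 < e)%R.
  have [k ke] := ltr_add_invr e0.
  by exists k; move: ke; rewrite add0r.
apply: (le_trans _ (le_trans (lB k) _)).
  by apply: le_measure; rewrite ?inE//; apply: bigcap_inf.
by rewrite leeD2l// lee_fin ltW.
Qed.

End lebesgue_borel.

(** * Euclidean norm and measurability of the kernel *)

Section enorm_theory.
Context {R : realType} {N : nat}.
Implicit Types x y z : 'rV[R]_N.

Lemma enorm_ge0 x : 0 <= enorm x.
Proof. exact: sqrtr_ge0. Qed.

Lemma enorm_sqr x : enorm x ^+ 2 = \sum_i x ord0 i ^+ 2.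
Proof. by rewrite sqr_sqrtr// sumr_ge0// => i _; exact: sqr_ge0. Qed.

Lemma coord_le_enorm x i : `|x ord0 i| <= enorm x.
Proof.
rewrite -sqrtr_sqr ler_wsqrtr// (bigD1 i)//= lerDl sumr_ge0// => j _.
exact: sqr_ge0.
Qed.

Lemma enorm_le_coord x (a : R) :
  0 <= a -> (forall i, `|x ord0 i| <= a) -> enorm x <= N%:R * a.
Proof.
move=> a0 xa; rewrite -[leRHS]ger0_norm ?mulr_ge0// -sqrtr_sqr ler_wsqrtr//.
apply: (@le_trans _ _ (\sum_(i < N) a ^+ 2)).
  apply: ler_sum => i _.
  by rewrite -[leLHS]ger0_norm ?sqr_ge0// normrX lerXn2r ?nnegrE.
rewrite sumr_const card_ord -[_ *+ N]mulr_natl exprMn ler_wpM2r ?sqr_ge0//.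
rewrite -natrX ler_nat; case: (N) => // n; exact: leq_pmulr.
Qed.

Lemma enorm0 : enorm (0 : 'rV[R]_N) = 0.
Proof. by rewrite /enorm big1 ?sqrtr0// => i _; rewrite mxE expr0n. Qed.

Lemma enorm_eq0 x : (enorm x == 0) = (x == 0).
Proof.
apply/eqP/eqP => [x0|->]; last exact: enorm0.
apply/rowP => i; rewrite mxE; apply/eqP; rewrite -normr_le0 -x0.
exact: coord_le_enorm.
Qed.

Lemma enorm_gt0 x : (0 < enorm x) = (x != 0).
Proof. by rewrite lt_def enorm_eq0 enorm_ge0 andbT. Qed.

Lemma enormN x : enorm (- x) = enorm x.
Proof. by congr Num.sqrt; apply: eq_bigr => i _; rewrite mxE sqrrN. Qed.

Lemma enormZ (c : R) x : enorm (c *: x) = `|c| * enorm x.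
Proof.
rewrite /enorm -sqrtr_sqr -sqrtrM ?sqr_ge0// mulr_sumr.
by congr Num.sqrt; apply: eq_bigr => i _; rewrite mxE exprMn.
Qed.

(** Cauchy-Schwarz comes termwise from a weighted Young inequality: with [a = |x|] and [b = |y|],
    twice [x_i y_i] is at most [b / a * x_i ^ 2 + a / b * y_i ^ 2], and these bounds add up to
    [2 a b]. The weights force the zero vectors to be treated apart. *)
Lemma enormD x y : enorm (x + y) <= enorm x + enorm y.
Proof.
have [/eqP|x0] := eqVneq (enorm x) 0.
  by rewrite enorm_eq0 => /eqP ->; rewrite add0r enorm0 add0r.
have [/eqP|y0] := eqVneq (enorm y) 0.
  by rewrite enorm_eq0 => /eqP ->; rewrite addr0 enorm0 addr0.
have {}x0 : 0 < enorm x by rewrite lt_def x0 enorm_ge0.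
have {}y0 : 0 < enorm y by rewrite lt_def y0 enorm_ge0.
rewrite -(@ler_pXn2r _ 2)// ?nnegrE ?addr_ge0 ?enorm_ge0//.
rewrite enorm_sqr sqrrD !enorm_sqr.
under eq_bigr do rewrite mxE sqrrD.
rewrite !big_split/= lerD2r lerD2l.
set a := enorm x; set b := enorm y.
apply: (@le_trans _ _ (\sum_i (b / a * x ord0 i ^+ 2 + a / b * y ord0 i ^+ 2))).
  rewrite -big_split/=; apply: ler_sum => i _; rewrite -mulr2n -subr_ge0.
  have ab : (a / b) * (b / a) = 1 by field; rewrite !lt0r_neq0.
  have -> : b / a * x ord0 i ^+ 2 + a / b * y ord0 i ^+ 2 -
      (x ord0 i * y ord0 i) *+ 2 =
      a / b * (b / a * x ord0 i - y ord0 i) ^+ 2.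
    by field; rewrite !lt0r_neq0.
  by rewrite mulr_ge0 ?sqr_ge0// divr_ge0 ?ltW.
rewrite big_split/= -!mulr_sumr -!enorm_sqr -/a -/b.
rewrite le_eqVlt; apply/orP; left; apply/eqP.
by field; rewrite !lt0r_neq0.
Qed.

Lemma lerB_enorm x y : enorm x - enorm y <= enorm (x - y).
Proof. by rewrite lerBlDr -[in leLHS](subrK y x) enormD. Qed.

Lemma measurable_enorm : measurable_fun setT (@enorm R N).
Proof.
apply: (@measurableT_comp _ _ _ _ _ _ (@Num.sqrt R) _
  (fun x : 'rV[R]_N => \sum_i x ord0 i ^+ 2)).
  apply: continuous_measurable_fun; exact: sqrt_continuous.
apply: measurable_sum => i; apply: (measurable_funX 2).
exact: measurable_coord.
Qed.

Lemma eball0E (r : R) x : eball 0 r x = (enorm x < r)%R :> Prop.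
Proof. by rewrite /eball/= subr0. Qed.

Lemma measurable_eball0 (r : R) : measurable (eball 0 r : set 'rV[R]_N).
Proof.
rewrite (_ : eball 0 r = (fun x => enorm x) @^-1` `]-oo, r[%classic); last first.
  by apply/seteqP; split => x; rewrite eball0E/= in_itv.
by rewrite -[X in measurable X]setTI; apply: measurable_enorm.
Qed.

End enorm_theory.

Section open_measurable.
Context {R : realType} {N : nat}.
Local Notation T := 'rV[R]_N.

Lemma rV_measurable_set (P : 'I_N -> set R) : (forall i, measurable (P i)) ->
  measurable [set x : T | forall i, P i (x ord0 i)].
Proof.
move=> mP; rewrite [X in measurable X](_ : _ = \bigcap_(i in [set: 'I_N])
    ((fun x : T => x ord0 i) @^-1` (P i))).
  apply: fin_bigcap_measurable => // i _.
  by rewrite -[X in measurable X]setTI; exact: measurable_coord.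
by apply/seteqP; split => x /= xab i => [_|]; exact: xab.
Qed.

(** The sigma-algebra on row vectors is generated by the coordinates, not by the topology. An open
    set is the union of the boxes with rational centre and radius [1 / (n + 1)] that it contains, a
    countable family. *)
Lemma open_rV_measurable (U : set T) : open U -> measurable U.
Proof.
move=> oU.
pose B (q : 'rV[rat]_N * nat) := [set y : T | forall i, 
   y ord0 i \in `](ratr (q.1 ord0 i) - q.2.+1%:R^-1), (ratr (q.1 ord0 i) + q.2.+1%:R^-1)[].
rewrite (_ : U = \bigcup_(q in [set q | B q `<=` U]) B q); last first.
  apply/seteqP; split => x; last by move=> [q /= + Bx]; exact.
  move=> Ux; have /nbhs_ballP[e/= e0 eU] := open_nbhs_nbhs (conj oU Ux).
  have [n ne] := ltr_add_invr e0; rewrite add0r in ne.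
  (* Half of [1 / (n + 1)]: a box of radius [d] whose centre is within [d] of [x] stays within [e]
     of [x]. *)
  pose d : R := (n.*2.+2)%:R^-1.
  have d0 : 0 < d by rewrite invr_gt0.
  have dd : d + d < e.
    have -> : d + d = n.+1%:R^-1; last by [].
    by rewrite /d -doubleS -muln2 natrM; field; rewrite addrC natr1 pnatr_eq0.
  have Q i : exists q : rat, ratr q \in `](x ord0 i - d), (x ord0 i + d)[.
    have : x ord0 i - d < x ord0 i + d by lra.
    by move=> /rat_in_itvoo.
  pose q := \row_i sval (cid (Q i)).
  have qi i : ratr (q ord0 i) \in `](x ord0 i - d), (x ord0 i + d)[.
    by rewrite /q mxE; case: cid.
  have dE : ((n.*2.+1).+1%:R^-1 = d :> R)%R by [].
  exists (q, n.*2.+1) => /=.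
    move=> y /= By; apply: eU => /=; rewrite /ball/= /mx_ball; split=> // j i.
    rewrite (ord1 j) /ball/=.
    move: (By i) (qi i); rewrite dE !in_itv/= => /andP[? ?] /andP[? ?].
    by rewrite ltr_norml; apply/andP; split; lra.
  move=> i /=; rewrite dE; move: (qi i); rewrite !in_itv/= => /andP[? ?].
  by apply/andP; split; lra.
rewrite bigcup_mkcond.
apply: countable_bigcupT_measurable => [|q]; first exact: countableP.
case: ifPn => // _; apply: (@rV_measurable_set (fun i => [set` _])) => i.
exact: measurable_itv.
Qed.

Lemma rV_measurable_set1 (a : T) : measurable [set a].
Proof.
rewrite (_ : [set a] = [set x : T | forall i, [set a ord0 i] (x ord0 i)]).
  apply: (rV_measurable_set (P := fun i => [set a ord0 i])) => i.
  exact: measurable_set1.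
by apply/seteqP; split => [x -> //|x /= xa]; apply/rowP.
Qed.

Lemma nonzero_nbhs (x : T) : x != 0 -> \forall y \near x, y != 0.
Proof.
move=> x0; near=> y; apply/eqP => y0.
have : `|x - y| < `|x|.
  near: y; apply: (@cvgr_dist_lt _ _ _ (nbhs x) _ id x) => //.
  by rewrite normr_gt0.
by rewrite y0 subr0 ltxx.
Unshelve. all: by end_near. Qed.

(** Away from the origin [K] is continuous, so its strict superlevel sets are open there; the
    origin, where [K] is unconstrained, adds at most a singleton. *)
Lemma locally_lipschitz_measurable (K : T -> R) :
  [locally [lipschitz (K x : R^o) | x in [set x | x != 0]]] ->
  measurable_fun setT K.
Proof.
move=> Klip.
have Kcont (x : T) (e : R) : x != 0 -> 0 < e -> \forall y \near x, `|K x - K y| <= e.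
  move=> x0 e0.
  have /= Lx := Klip (x, x) (conj x0 x0).
  have [M [Mreal ML]] := Lx.
  pose M' := `|M| + 1.
  have M0 : 0 < M' by rewrite /M' ltr_wpDl.
  have MM' : M < M' by rewrite /M' (le_lt_trans (ler_norm M))// ltrDl.
  have {ML}ML : nbhs (x, x) [set z : T * T | z.1 != 0 /\ z.2 != 0 ->
    `|K z.1 - K z.2| <= M' * `|z.1 - z.2|] by exact: ML _ MM'.
  have [[U V] [/= nU nV] UV] := ML.
  have x0n := nonzero_nbhs x0.
  near=> y.
  rewrite distrC; apply: (@le_trans _ _ (M' * `|y - x|)).
    apply: (UV (y, x)) => /=; last by split=> //; near: y.
    by split; [near: y|exact: nbhs_singleton].
  rewrite mulrC -ler_pdivlMr// distrC; near: y.
  have eM : 0 < e / M' by rewrite divr_gt0.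
  exact: (@cvgr_dist_le _ _ _ (nbhs x) _ id x _ _ eM).
have mK a : measurable [set x | a < K x].
  rewrite (_ : [set _ | _] = [set x | x != 0 /\ a < K x] `|`
      (if a < K 0 then [set 0] else set0)); last first.
    apply/seteqP; split => x /=.
      move=> aK; have [x0|x0] := eqVneq x 0; last by left.
      by right; rewrite -x0 aK.
    by move=> [[]//|]; case: ifPn => // ? ->.
  apply: measurableU; last by case: ifPn => // _; exact: rV_measurable_set1.
  apply: open_rV_measurable; rewrite openE => x /= [x0 aK].
  rewrite /interior.
  have e0 : 0 < (K x - a) / 2 by rewrite divr_gt0// subr_gt0.
  near=> y; split; first by near: y; exact: nonzero_nbhs.
  have : `|K x - K y| <= (K x - a) / 2.
    near: y; exact: (Kcont x ((K x - a) / 2) x0 e0).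
  by rewrite ler_norml => /andP[? ?]; lra.
apply: (measurability _ (RGenOInfty.measurableE R)).
move=> _ [_ [a ->] <-]; rewrite setTI preimage_itvoy; exact: mK.
Unshelve. all: by end_near. Qed.

End open_measurable.

(** * Cubes and integrable majorants of power singularities *)

Section cubes.
Context {R : realType} (N : nat).
Local Notation T := 'rV[R]_N.
Local Notation mu := (@borel_lebesgue R N : {measure set T -> \bar R}).

Definition cube (a : R) : set T := [set z | forall i, z ord0 i \in `[- a, a]].

Lemma measurable_cube a : measurable (cube a).
Proof.
apply: (rV_measurable_set (P := fun i => [set` `[- a, a]])) => i.
exact: measurable_itv.
Qed.

Lemma borel_lebesgue_cube a : 0 <= a -> mu (cube a) = ((2 * a) ^+ N)%:E.
Proof.
move=> a0.
pose u : T := const_mx (- a); pose v : T := const_mx a.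
have -> : cube a = [set x | forall i, x ord0 i \in `[u ord0 i, v ord0 i]].
  by apply/seteqP; split => z /= za i; have := za i; rewrite !mxE.
rewrite [LHS](@borel_lebesgue_box R N u v) => [|i]; last by rewrite !mxE; lra.
under eq_bigr do rewrite !mxE opprK -mulr2n -mulr_natl.
by rewrite prodr_const card_ord.
Qed.

Lemma enorm_cube a z : 0 <= a -> cube a z -> enorm z <= N%:R * a.
Proof.
move=> a0 za; apply: enorm_le_coord => // i.
by rewrite ler_norml; have := za i; rewrite in_itv.
Qed.

Lemma cube_enorm a z : enorm z <= a -> cube a z.
Proof.
move=> za i; rewrite in_itv/= -ler_norml; exact: le_trans (coord_le_enorm _ _) za.
Qed.

Local Open Scope ereal_scope.

Lemma le_series_geometric (a r : R) : (0 <= a)%R -> (0 <= r < 1)%R ->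
  \sum_(k <oo) (a * r ^+ k)%:E < +oo.
Proof.
move=> a0 /andP[r0 r1].
apply: (@le_lt_trans _ _ (a / (1 - r))%:E); last by rewrite ltry.
have ar k : 0 <= (a * r ^+ k)%:E by rewrite lee_fin mulr_ge0// exprn_ge0.
apply: lime_le; first by apply: is_cvg_nneseries.
apply: nearW => n; rewrite sumEFin lee_fin.
have := @geometric_seriesE R a r (negbT (lt_eqF r1)).
move=> /(congr1 (fun f => f n)); rewrite /series/= => ->.
apply: ler_wpM2r; first by rewrite invr_ge0 subr_ge0 ltW.
by apply: ler_piMr => //; rewrite gerBl exprn_ge0.
Qed.

(** The majorant is a sum over dyadic cubes: weight [q ^ (k + 1)], with [q = 2 ^ p], on the cube of
    half-side [2 ^ -k]. On the shell [2 ^ -(k + 1) <= |z| < 2 ^ -k] that single term already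
    dominates [|z| ^ -p], and the integrals form a geometric series of ratio [2 ^ p / 2 ^ N < 1].
    The value [+oo] at the origin makes pointwise comparisons with [newton], infinite there as well,
    hold without exception. *)
Lemma singular_majorant (p : R) : (0 <= p < N%:R)%R ->
  exists h : T -> \bar R, [/\ measurable_fun setT h, forall x, 0 <= h x,
    h 0%R = +oo,
    forall z, (0 < enorm z < 1)%R -> (enorm z `^ (- p))%:E <= h z &
    \int[mu]_x h x < +oo].
Proof.
move=> /andP[p0 pN].
pose q : R := (2 `^ p)%R.
have q0 : (0 < q)%R by rewrite powR_gt0.
have q1 : (1 <= q)%R.
  by rewrite -[leLHS](powRr0 2%R) ler_powR// ler1n.
have qN : (q < 2 ^+ N)%R.
  by rewrite -powR_mulrn// /q /powR pnatr_eq0/= ltr_expR ltr_pM2r// ln_gt0// ltr1n.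
pose f k (z : T) := (q ^+ k.+1 * \1_(cube (2^-1 ^+ k)) z)%:E.
have f0 k z : 0 <= f k z by rewrite lee_fin mulr_ge0// exprn_ge0// ltW.
have mf k : measurable_fun setT (f k).
  apply/measurable_EFinP; apply: measurable_funM => //.
  apply: measurable_indic; exact: measurable_cube.
exists (fun z => \sum_(k <oo) f k z); split.
- rewrite (_ : (fun z => _) = (fun z => \sum_(k <oo | k \in xpredT) f k z))//.
  by apply: ge0_emeasurable_sum => // k z _ _; exact: f0.
- by move=> x; exact: nneseries_ge0.
- apply: eq_infty => x.
  apply: (le_trans _ (nneseries_lim_ge (P := xpredT) (m := 0%N) (Num.truncn x).+1
    (fun k _ _ => f0 k 0%R))).
  rewrite sumEFin lee_fin; apply: (le_trans (ltW (truncnS_gt x))).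
  apply: (@le_trans _ _ (\sum_(0 <= k < (Num.truncn x).+1) 1)%R).
    by rewrite sumr_const_nat subn0.
  apply: ler_sum => k _.
  rewrite indicE mem_set ?mulr1; last by apply: cube_enorm; rewrite enorm0 exprn_ge0.
  exact: exprn_ege1.
- move=> z /andP[z0 z1].
  have ex_k : exists k : nat, (2^-1 ^+ k <= enorm z)%R.
    exists (Num.truncn (enorm z)^-1).+1.
    rewrite exprVn invf_ple ?posrE ?exprn_gt0//.
    apply: (le_trans (ltW (truncnS_gt _))).
    by rewrite -natrX ler_nat ltnW// ltn_expl.
  case: (ex_minnP ex_k) => -[|k] kz kmin; first by rewrite leNgt z1 in kz.
  have zk : (enorm z < 2^-1 ^+ k)%R.
    by rewrite ltNge; apply/negP => /kmin; rewrite ltnn.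
  apply: (@le_trans _ _ (f k z)).
    rewrite lee_fin indicE mem_set ?mulr1; last exact/cube_enorm/ltW.
    have -> : (q ^+ k.+1 = (2 ^+ k.+1) `^ p)%R.
      by rewrite -!powR_mulrn ?ltW// /q -!powRrM mulrC.
    have -> : (enorm z `^ (- p) = (enorm z)^-1 `^ p)%R.
      by rewrite -powR_inv1 ?ltW// -powRrM mulN1r.
    apply: ge0_ler_powR => //.
    - by rewrite nnegrE invr_ge0 ltW.
    - by rewrite nnegrE exprn_ge0.
    - by rewrite invf_ple ?posrE ?exprn_gt0// -exprVn.
  rewrite (nneseries_split 0%N k.+1) => [|j _]; last exact: f0.
  rewrite big_nat_recr//= -addeA addeCA leeDl// adde_ge0//.
    by apply: sume_ge0 => j _; exact: f0.
  by apply: nneseries_ge0.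
- rewrite integral_nneseries//.
  rewrite (eq_eseriesr (g := fun k => (q * 2 ^+ N * (q / 2 ^+ N) ^+ k)%:E)).
    apply: le_series_geometric; first by rewrite mulr_ge0// ltW.
    by rewrite divr_ge0 ?ltW//= ltr_pdivrMr ?mul1r.
  move=> k _; rewrite /f.
  under eq_integral do rewrite EFinM.
  rewrite ge0_integralZl_EFin//; last 2 first.
  - by apply/measurable_EFinP; apply: measurable_indic; exact: measurable_cube.
  - by rewrite exprn_ge0// ltW.
  rewrite integral_indic//; last exact: measurable_cube.
  rewrite setIT borel_lebesgue_cube// -EFinM; congr EFin.
  rewrite exprS !exprMn.
  rewrite (_ : (2^-1 ^+ k) ^+ N = (2 ^+ N)^-1 ^+ k)%R; last first.
    by rewrite -exprM mulnC exprM exprVn.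
  by ring.
Qed.

End cubes.

(** * Double integrals against a convolution kernel *)

Section pair_energy.
Context {R : realType} (N : nat).
Local Open Scope ereal_scope.
Local Notation T := 'rV[R]_N.
Local Notation lam := (@borel_lebesgue R N).
Local Notation mu := (@borel_lebesgue R N : {measure set T -> \bar R}).
Implicit Types (A B F G : set T) (k : T -> \bar R) (w : T * T -> R).

Lemma measurable_integral1 (f : T * T -> \bar R) :
  measurable_fun setT f -> (forall z, 0 <= f z) ->
  measurable_fun setT (fun y => \int[mu]_x f (x, y)).
Proof. by move=> mf f0; exact: (@measurable_fun_fubini_tonelli_G _ _ _ _ _ lam). Qed.

Lemma integral_swap (f : T * T -> \bar R) :
  measurable_fun setT f -> (forall z, 0 <= f z) ->
  \int[mu]_x \int[mu]_y f (x, y) = \int[mu]_y \int[mu]_x f (x, y).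
Proof. by move=> mf f0; exact: (@fubini_tonelli _ _ _ _ _ lam lam). Qed.

Lemma measurable_rV_preim (v : T) A : measurable A ->
  measurable [set x : T | A (x + v)%R].
Proof.
by move=> mA; rewrite -[X in measurable X]setTI; exact: measurable_rV_shift.
Qed.

Lemma measurable_leaving (v : T) F : measurable F ->
  measurable [set y : T | F y /\ ~ F (y + v)%R].
Proof.
move=> mF; rewrite (_ : [set y | _] = F `\` [set x | F (x + v)%R])//.
by apply: measurableD => //; exact: measurable_rV_preim.
Qed.

(** Perimeter and Coulomb energy are both integrals of [k (x - y)] against a weight built from
    indicators. Relations between the energies of several sets thereby reduce to pointwise relations
    between weights, decided by cases on membership. *)
Definition pair_energy k w : \bar R :=
  \int[(lam \x lam)%E]_z (k (z.1 - z.2)%R * (w z)%:E).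

Definition rect A B (z : T * T) : R := \1_A z.1 * \1_B z.2.

Lemma rect_ge0 A B z : (0 <= rect A B z)%R.
Proof. by rewrite mulr_ge0. Qed.

Lemma measurable_rect A B : measurable A -> measurable B ->
  measurable_fun setT (rect A B).
Proof.
move=> mA mB; apply: measurable_funM.
  by apply: (measurableT_comp (measurable_indic mA)); exact: measurable_fst.
by apply: (measurableT_comp (measurable_indic mB)); exact: measurable_snd.
Qed.

Lemma measurable_diff_kernel k : measurable_fun setT k ->
  measurable_fun setT (fun z : T * T => k (z.1 - z.2)%R).
Proof.
move=> mk; apply: (measurableT_comp mk).
by apply: measurable_fun_rVB; [exact: measurable_fst|exact: measurable_snd].
Qed.

Lemma measurable_pair_integrand k w :
  measurable_fun setT k -> measurable_fun setT w ->
  measurable_fun setT (fun z : T * T => k (z.1 - z.2)%R * (w z)%:E).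
Proof.
move=> mk mw; apply: emeasurable_funM; first exact: measurable_diff_kernel.
exact/measurable_EFinP.
Qed.

Section kernel.
Variable k : T -> \bar R.
Hypotheses (mk : measurable_fun setT k) (k0 : forall x, 0 <= k x).

Lemma pair_energy_ge0 w : (forall z, 0 <= w z)%R -> 0 <= pair_energy k w.
Proof. by move=> w0; apply: integral_ge0 => z _; rewrite mule_ge0// lee_fin. Qed.

Lemma le_pair_energy w1 w2 : measurable_fun setT w1 -> measurable_fun setT w2 ->
  (forall z, 0 <= w1 z)%R -> (forall z, w1 z <= w2 z)%R ->
  pair_energy k w1 <= pair_energy k w2.
Proof.
move=> mw1 mw2 w10 w12; apply: ge0_le_integral => //.
- by move=> z _; rewrite mule_ge0// lee_fin.
- exact: measurable_pair_integrand.
- exact: measurable_pair_integrand.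
- by move=> z _; apply: lee_wpmul2l => //; rewrite lee_fin.
Qed.

Lemma pair_energyD w1 w2 : measurable_fun setT w1 -> measurable_fun setT w2 ->
  (forall z, 0 <= w1 z)%R -> (forall z, 0 <= w2 z)%R ->
  pair_energy k (fun z => w1 z + w2 z)%R = pair_energy k w1 + pair_energy k w2.
Proof.
move=> mw1 mw2 w10 w20; rewrite /pair_energy -ge0_integralD//.
- apply: eq_integral => z _; rewrite EFinD ge0_muleDr// lee_fin//.
- by move=> z _; rewrite mule_ge0// lee_fin.
- exact: measurable_pair_integrand.
- by move=> z _; rewrite mule_ge0// lee_fin.
- exact: measurable_pair_integrand.
Qed.

Lemma pair_energy_fubini w : measurable_fun setT w -> (forall z, 0 <= w z)%R ->
  pair_energy k w = \int[mu]_y \int[mu]_x (k (x - y)%R * (w (x, y))%:E).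
Proof.
move=> mw w0; rewrite /pair_energy fubini_tonelli2//.
- exact: measurable_pair_integrand.
- by move=> z; rewrite mule_ge0// lee_fin.
Qed.

Lemma pair_energy_shift w (v : T) :
  measurable_fun setT w -> (forall z, 0 <= w z)%R ->
  pair_energy k (fun z => w (z.1 + v, z.2 + v)%R) = pair_energy k w.
Proof.
move=> mw w0.
have mw' : measurable_fun setT (fun z : T * T => w (z.1 + v, z.2 + v)%R).
  apply: (measurableT_comp mw); apply: measurable_fun_pair.
    by apply: (measurableT_comp (measurable_rV_shift v)); exact: measurable_fst.
  by apply: (measurableT_comp (measurable_rV_shift v)); exact: measurable_snd.
pose f z := k (z.1 - z.2)%R * (w z)%:E.
have mf : measurable_fun setT f := measurable_pair_integrand mk mw.
have f0 z : 0 <= f z by rewrite mule_ge0// lee_fin.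
rewrite (pair_energy_fubini mw' (fun z => w0 _)) (pair_energy_fubini mw w0).
rewrite -[RHS](ge0_integral_shift v (f := fun y => \int[mu]_x f (x, y))); last 2 first.
- exact: measurable_integral1 mf f0.
- by move=> y; apply: integral_ge0 => x _; exact: f0.
apply: eq_integral => y _.
rewrite -[RHS](ge0_integral_shift v (f := fun x => f (x, y + v)%R)); last 2 first.
- exact: (measurable_fun_pair1 (y + v)%R mf).
- by move=> x; exact: f0.
apply: eq_integral => x _; rewrite /f/=; congr (k _ * _).
by rewrite opprD addrACA subrr addr0.
Qed.

Lemma pair_energy_sym w : (forall x, k (- x)%R = k x) ->
  measurable_fun setT w -> (forall z, 0 <= w z)%R ->
  pair_energy k (fun z => w (z.2, z.1)) = pair_energy k w.
Proof.
move=> kN mw w0.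
have mw' : measurable_fun setT (fun z : T * T => w (z.2, z.1)).
  apply: (measurableT_comp mw); apply: measurable_fun_pair.
    exact: measurable_snd.
  exact: measurable_fst.
rewrite (pair_energy_fubini mw' (fun z => w0 _)) (pair_energy_fubini mw w0).
pose f z := k (z.1 - z.2)%R * (w z)%:E.
rewrite -[RHS](@integral_swap f); last 2 first.
- exact: measurable_pair_integrand.
- by move=> z; rewrite mule_ge0// lee_fin.
apply: eq_integral => y _; apply: eq_integral => x _; rewrite /f/=.
by rewrite -kN opprB.
Qed.

(** The substitution [x = y + z] separates the kernel from the set, and Tonelli integrates over [y]
    before [z]. The remaining factor is the covariogram deficit of [F], later called [leaving]. *)
Lemma pair_energy_covariogram F :  measurable F ->
  pair_energy k (rect (~` F) F) = 
  \int[mu]_z (k z * mu [set y | F y /\ ~ F (y + z)%R]).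
Proof.
move=> mF; have mFc := measurableC mF.
rewrite pair_energy_fubini//; [|exact: measurable_rect|exact: rect_ge0].
pose f (z : T * T) := k z.1 * (\1_(~` F) (z.1 + z.2)%R * \1_F z.2)%:E.
have mf : measurable_fun setT f.
  apply: emeasurable_funM; first by apply: (measurableT_comp mk); exact: measurable_fst.
  apply/measurable_EFinP; apply: measurable_funM.
    apply: (measurableT_comp (measurable_indic mFc)).
    by apply: measurable_fun_rVD; [exact: measurable_fst|exact: measurable_snd].
  by apply: (measurableT_comp (measurable_indic mF)); exact: measurable_snd.
have f0 z : 0 <= f z by rewrite mule_ge0// lee_fin mulr_ge0.
transitivity (\int[mu]_y \int[mu]_x f (x, y)).
  apply: eq_integral => y _.
  rewrite -[LHS](ge0_integral_shift y
    (f := fun x => k (x - y)%R * (rect (~` F) F (x, y))%:E)); last 2 first.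
  - have := measurable_pair_integrand mk (measurable_rect mFc mF).
    exact: (measurable_fun_pair1 y).
  - by move=> x; rewrite mule_ge0// lee_fin rect_ge0.
  by apply: eq_integral => x _; rewrite addrK.
rewrite -(integral_swap mf f0).
apply: eq_integral => z _.
have mD := measurable_leaving z mF.
rewrite -[in RHS](setIT [set y | _]) -integral_indic// -ge0_integralZl//.
  apply: eq_integral => y _; rewrite /f/=; congr (_ * _%:E).
  rewrite !indicE [(z + y)%R]addrC.
  have [yF|yF] := pselect (F y); have [yzF|yzF] := pselect (F (y + z)%R).
  - by rewrite (mem_set yF) memNset ?memNset ?mul0r//= => -[].
  - by rewrite !mem_set// mulr1.
  - by rewrite (memNset yF) mulr0 memNset// => -[].
  - by rewrite (memNset yF) mulr0 memNset// => -[].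
by apply/measurable_EFinP; exact: measurable_indic.
Qed.

End kernel.
End pair_energy.

Section set_energy.
Context {R : realType} (N : nat).
Local Open Scope ereal_scope.
Local Notation T := 'rV[R]_N.
Local Notation lam := (@borel_lebesgue R N).
Local Notation mu := (@borel_lebesgue R N : {measure set T -> \bar R}).
Variable k : T -> \bar R.
Hypotheses (mk : measurable_fun setT k) (k0 : forall x, 0 <= k x).
Implicit Types A B F G : set T.

Definition crossing F := pair_energy k (rect (~` F) F).
Definition mutual A B := pair_energy k (rect A B).

Lemma crossing_ge0 F : 0 <= crossing F.
Proof. by apply: pair_energy_ge0 => // z; exact: rect_ge0. Qed.

Lemma mutual_ge0 A B : 0 <= mutual A B.
Proof. by apply: pair_energy_ge0 => // z; exact: rect_ge0. Qed.

Let mrD A B A' B' : measurable A -> measurable B -> measurable A' -> measurable B' ->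
  measurable_fun setT (fun z => rect A B z + rect A' B' z : R)%R.
Proof. by move=> *; apply: measurable_funD; exact: measurable_rect. Qed.

Let rD A B A' B' z : (0 <= rect A B z + rect A' B' z :> R)%R.
Proof. by rewrite addr_ge0 ?rect_ge0. Qed.

Lemma mutualD A B A' B' :
  measurable A -> measurable B -> measurable A' -> measurable B' ->
  mutual A B + mutual A' B' =
  pair_energy k (fun z => rect A B z + rect A' B' z)%R.
Proof.
move=> mA mB mA' mB'; rewrite pair_energyD//; try exact: measurable_rect;
  by move=> z; exact: rect_ge0.
Qed.

(** Sixteen cases on the memberships of [x] and [y]. The weights differ only on pairs with one point
    in [F \ G] and the other in [G \ F], which are lost on the left. *)
Lemma le_crossingUI F G : measurable F -> measurable G ->
  crossing (F `|` G) + crossing (F `&` G) <= crossing F + crossing G.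
Proof.
move=> mF mG.
have mU := measurableU _ _ mF mG; have mI := measurableI _ _ mF mG.
have mFc := measurableC mF; have mGc := measurableC mG.
have mUc := measurableC mU; have mIc := measurableC mI.
rewrite /crossing -!/(mutual _ _) !mutualD//.
apply: le_pair_energy => //; try exact: mrD.
move=> [x y]; rewrite /rect/= !indicE !(in_setU, in_setI, in_setC, in_setD).
by case: (x \in F); case: (x \in G); case: (y \in F); case: (y \in G);
  rewrite /=; lra.
Qed.

(** Repulsion goes the other way: pairs joining the two differences are gained by the union. The
    bound is useful because both differences will have the small volume [d] and the Newton potential
    is bounded, so the defect is [O(d)]. *)
Lemma le_mutualUI F G : measurable F -> measurable G ->
  mutual (F `|` G) (F `|` G) + mutual (F `&` G) (F `&` G) <=
  (mutual F F + mutual G G) +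
  (mutual (F `\` G) (G `\` F) + mutual (G `\` F) (F `\` G)).
Proof.
move=> mF mG.
have mU := measurableU _ _ mF mG; have mI := measurableI _ _ mF mG.
have mFG := measurableD mF mG; have mGF := measurableD mG mF.
rewrite !mutualD// -pair_energyD//; try exact: mrD; try by move=> z; exact: rD.
apply: le_pair_energy => //; first exact: mrD.
  by apply: measurable_funD; exact: mrD.
move=> [x y]; rewrite /rect/= !indicE !(in_setU, in_setI, in_setC, in_setD).
by case: (x \in F); case: (x \in G); case: (y \in F); case: (y \in G);
  rewrite /=; lra.
Qed.

(** Pairs with one point in each piece are interior to [E], but each of the two orders is counted
    once in the perimeters of the pieces. *)
Lemma crossing_cut E B : measurable E -> measurable B ->
  crossing E + (mutual (E `&` B) (E `\` B) + mutual (E `\` B) (E `&` B)) =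
  crossing (E `&` B) + crossing (E `\` B).
Proof.
move=> mE mB.
have mI := measurableI _ _ mE mB; have mD := measurableD mE mB.
have mIc := measurableC mI; have mDc := measurableC mD; have mEc := measurableC mE.
rewrite /crossing -!/(mutual _ _) !mutualD//.
rewrite -[mutual (~` E) E]/(pair_energy k (rect (~` E) E)).
rewrite -(pair_energyD mk k0 (measurable_rect mEc mE) (mrD mI mD mD mI)
  (fun z => rect_ge0 _ _ z) (fun z => rD _ _ _ _ z)).
congr pair_energy; apply/funext => -[x y].
rewrite /rect/= !indicE !(in_setU, in_setI, in_setC, in_setD).
by case: (x \in E); case: (x \in B); case: (y \in E); case: (y \in B);
  rewrite /=; lra.
Qed.

Lemma mutualC A B : (forall x, k (- x)%R = k x) -> measurable A -> measurable B ->
  mutual A B = mutual B A.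
Proof.
move=> kN mA mB; rewrite /mutual -[LHS](pair_energy_sym mk k0 kN)//; last 2 first.
- exact: measurable_rect.
- by move=> z; exact: rect_ge0.
by congr pair_energy; apply/funext => -[x y]; rewrite /rect/= mulrC.
Qed.

Lemma mutual_shift v A B : measurable A -> measurable B ->
  mutual [set x | A (x + v)%R] [set x | B (x + v)%R] = mutual A B.
Proof.
move=> mA mB; rewrite /mutual -[RHS](pair_energy_shift mk k0 v)//.
- exact: measurable_rect.
- by move=> z; exact: rect_ge0.
Qed.

Lemma crossing_shift v F : measurable F ->
  crossing [set x | F (x + v)%R] = crossing F.
Proof. by move=> mF; apply: (mutual_shift v (measurableC mF) mF). Qed.

Lemma le_mutual A B A' B' :
  measurable A -> measurable B -> measurable A' -> measurable B' ->
  A `<=` A' -> B `<=` B' -> mutual A B <= mutual A' B'.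
Proof.
move=> mA mB mA' mB' AA' BB'; apply: le_pair_energy => //; try exact: measurable_rect.
  by move=> z; exact: rect_ge0.
move=> [x y]; rewrite /rect/=; apply: ler_pM => //.
  by rewrite !indicE ler_nat; case: (boolP (x \in A)) => // /set_mem/AA'/mem_set ->.
by rewrite !indicE ler_nat; case: (boolP (y \in B)) => // /set_mem/BB'/mem_set ->.
Qed.

Lemma measurable_translate (y : T) : measurable_fun setT (fun x : T => k (x - y)%R).
Proof.
by apply: (measurableT_comp mk); apply: measurable_fun_rVB => //; exact: measurable_cst.
Qed.

Lemma measurable_potential_integral A : measurable A ->
  measurable_fun setT (fun y : T => \int[mu]_x (k (x - y)%R * (\1_A x)%:E)).
Proof.
move=> mA.
apply: (@measurable_integral1 _ _ (fun z => k (z.1 - z.2)%R * (\1_A z.1)%:E)).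
  apply: emeasurable_funM; first exact: measurable_diff_kernel.
  by apply/measurable_EFinP; apply: (measurableT_comp (measurable_indic mA)); exact: measurable_fst.
by move=> z; rewrite mule_ge0// lee_fin.
Qed.

Lemma measurable_potential A (y : T) : measurable A ->
  measurable_fun setT (fun x : T => k (x - y)%R * (\1_A x)%:E).
Proof.
move=> mA; apply: emeasurable_funM; last exact/measurable_EFinP/measurable_indic.
by apply: (measurableT_comp mk); apply: measurable_fun_rVB => //; exact: measurable_cst.
Qed.

Lemma mutual_fubini A B : measurable A -> measurable B ->
  mutual A B = \int[mu]_y ((\int[mu]_x (k (x - y)%R * (\1_A x)%:E)) * (\1_B y)%:E).
Proof.
move=> mA mB; rewrite /mutual pair_energy_fubini//; last 2 first.
- exact: measurable_rect.
- by move=> z; exact: rect_ge0.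
apply: eq_integral => y _; rewrite -ge0_integralZr//.
- by apply: eq_integral => x _; rewrite /rect/= EFinM muleA.
- exact: measurable_potential.
- by move=> x _; rewrite mule_ge0// lee_fin.
Qed.

Lemma le_mutual_cst A B (C : \bar R) : measurable A -> measurable B ->
  (forall y, \int[mu]_x (k (x - y)%R * (\1_A x)%:E) <= C) ->
  mutual A B <= C * mu B.
Proof.
move=> mA mB kC.
have mI := measurable_potential_integral mA.
have I0 y : 0 <= \int[mu]_x (k (x - y)%R * (\1_A x)%:E).
  by apply: integral_ge0 => x _; rewrite mule_ge0// lee_fin.
have C0 : 0 <= C by exact: le_trans (I0 0%R) (kC 0%R).
rewrite mutual_fubini//.
apply: (@le_trans _ _ (\int[mu]_y (C * (\1_B y)%:E))).
  apply: ge0_le_integral => //.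
  - by move=> y _; rewrite mule_ge0// lee_fin.
  - by apply: emeasurable_funM => //; exact/measurable_EFinP/measurable_indic.
  - by apply: emeasurable_funM => //; exact/measurable_EFinP/measurable_indic.
  - by move=> y _; apply: lee_wpmul2r => //; rewrite lee_fin.
rewrite ge0_integralZl//; last exact/measurable_EFinP/measurable_indic.
by rewrite integral_indic// setIT.
Qed.

End set_energy.

(** * Reduction of the energy to Borel sets *)

Section energy_borel.
Context {R : realType} (N : nat).
Local Open Scope ereal_scope.
Local Notation T := 'rV[R]_N.
Local Notation lam := (@borel_lebesgue R N).
Local Notation mu := (@borel_lebesgue R N : {measure set T -> \bar R}).

Definition newton (x : T) : \bar R := (enorm x)%:E^-1.

Lemma newton_ge0 x : 0 <= newton x.
Proof. by rewrite inve_ge0 lee_fin enorm_ge0. Qed.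

Lemma measurable_newton : measurable_fun setT newton.
Proof.
rewrite (_ : newton = fun x => if enorm x == 0%R then +oo else (enorm x `^ (-1))%:E).
  apply: measurable_fun_ifT => //.
  - apply: (measurable_fun_eqr (f := @enorm R N)); first exact: measurable_enorm.
    exact: measurable_cst.
  - apply/measurable_EFinP; apply: (measurableT_comp (measurable_powR (-1))).
    exact: measurable_enorm.
apply/funext => x; rewrite /newton inver; case: ifPn => // _.
by rewrite powR_inv1// enorm_ge0.
Qed.

Definition nuclear (B : set T) := \int[mu]_x (newton x * (\1_B x)%:E).

Variables (K : T -> R).
Hypotheses (mK : measurable_fun setT K) (K0 : forall x, (0 <= K x)%R).

Let mk : measurable_fun setT (EFin \o K).
Proof. exact/measurable_EFinP. Qed.

Let k0 x : 0 <= (EFin \o K) x.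
Proof. by rewrite lee_fin. Qed.

Lemma integral_indicator (B : set T) (f : T -> \bar R) :
  measurable B -> measurable_fun setT f -> (forall x, 0 <= f x) ->
  \int[lebesgue_rV]_(x in B) f x = \int[mu]_x (f x * (\1_B x)%:E).
Proof.
move=> mB mf f0.
have mB' := lebesgue_measurable_borel mB.
rewrite integral_mkcond -ge0_integral_lebesgue_borel.
- by apply: eq_integral => x _; rewrite epatch_indic.
- by apply: emeasurable_funM => //; exact/measurable_EFinP/measurable_indic.
- by move=> x; rewrite mule_ge0// lee_fin.
Qed.

Let measurable_completed (f : T -> \bar R) D : measurable_fun setT f ->
  @measurable_fun _ _ (caratheodory_type ((@borel_lebesgue R N)^*)%mu) _ D f.
Proof.
move=> mf mD Y mY; apply: measurableI => //.
apply: lebesgue_measurable_borel.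
by rewrite -[X in measurable X]setTI; exact: mf.
Qed.

Let integral_hull (E B : set T) (f : T -> \bar R) :
  lebesgue_measurable E -> measurable B -> E `<=` B ->
  lebesgue_rV (B `\` E) = 0 -> measurable_fun setT f -> (forall x, 0 <= f x) ->
  \int[lebesgue_rV]_(x in E) f x = \int[mu]_x (f x * (\1_B x)%:E).
Proof.
move=> mE mB EB BE0 mf f0; rewrite -integral_indicator//.
have mB' := lebesgue_measurable_borel mB.
rewrite -{1}(setIidr EB) -setDD; apply/esym.
apply: (@ge0_negligible_integral _ (caratheodory_type ((@borel_lebesgue R N)^*)%mu)) => //.
- exact: measurableD.
- exact: measurable_completed.
Qed.

Let integral_hullC (E B : set T) (f : T -> \bar R) :
  lebesgue_measurable E -> measurable B -> E `<=` B ->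
  lebesgue_rV (B `\` E) = 0 -> measurable_fun setT f -> (forall x, 0 <= f x) ->
  \int[lebesgue_rV]_(x in ~` E) f x = \int[mu]_x (f x * (\1_(~` B) x)%:E).
Proof.
move=> mE mB EB BE0 mf f0; rewrite -integral_indicator//; last exact: measurableC.
have mB' := lebesgue_measurable_borel mB.
have -> : ~` B = ~` E `\` (B `\` E).
  apply/seteqP; split => x /=; first by move=> Bx; split => [/EB|[]].
  by move=> [Ex BEx] Bx; exact: BEx.
apply: (@ge0_negligible_integral _ (caratheodory_type ((@borel_lebesgue R N)^*)%mu)) => //.
- exact: measurableD.
- exact: measurableC.
- exact: measurable_completed.
Qed.

(** Changing a set by a null set affects neither the inner integrals, at any [y], nor the outer one.
    The case [E = B] also evaluates the energy of Borel competitors. *)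
Lemma energy_hull (A : R) (E B : set T) :
  lebesgue_measurable E -> measurable B -> E `<=` B ->
  lebesgue_rV (B `\` E) = 0 ->
  energy K A E = crossing (EFin \o K) B + (2^-1)%:E * mutual newton B B -
    A%:E * nuclear B.
Proof.
move=> mE mB EB BE0.
rewrite /energy; congr (_ + _ - _ * _).
- have mBc := measurableC mB.
  rewrite -[RHS]/(mutual _ _ _) (mutual_fubini mk k0 mBc mB).
  rewrite -(integral_hull mE mB EB BE0 (measurable_potential_integral mk k0 mBc)).
    apply: eq_integral => y _; apply: (integral_hullC mE mB EB BE0).
      exact: (measurable_translate mk).
    by move=> x; rewrite lee_fin.
  by move=> y; apply: integral_ge0 => x _; rewrite mule_ge0// lee_fin.
- rewrite /coulomb; congr (_ * _).
  rewrite (mutual_fubini measurable_newton newton_ge0 mB mB).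
  rewrite -(integral_hull mE mB EB BE0
    (measurable_potential_integral measurable_newton newton_ge0 mB)).
    apply: eq_integral => y _; apply: (integral_hull mE mB EB BE0).
      exact: (measurable_translate measurable_newton).
    by move=> x; exact: newton_ge0.
  move=> y; apply: integral_ge0 => x _; rewrite mule_ge0// ?lee_fin//.
  exact: newton_ge0.
- rewrite /attraction; exact: (integral_hull mE mB EB BE0 measurable_newton newton_ge0).
Qed.

End energy_borel.

(** * Translates of a set *)

Section leaving.
Context {R : realType} (N : nat).
Local Open Scope ereal_scope.
Local Notation T := 'rV[R]_N.
Local Notation mu := (@borel_lebesgue R N : {measure set T -> \bar R}).
Implicit Types F : set T.

Definition translate (v : T) F : set T := [set x | F (x + v)%R].

Lemma measurable_translate_set v F : measurable F -> measurable (translate v F).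
Proof. exact: measurable_rV_preim. Qed.

Lemma leb_translate v F : measurable F -> mu (translate v F) = mu F.
Proof. exact: borel_lebesgue_shift. Qed.

(** For [F] of finite measure this is [|F|] minus the covariogram of [F] at [v], half the L1
    distance between the indicators of [F] and its translate. It vanishes at zero, is even and is
    subadditive in [v]; these properties drive every estimate on it. *)
Definition leaving F v := mu (F `\` translate v F).

Lemma leaving_ge0 F v : 0 <= leaving F v.
Proof. exact: measure_ge0. Qed.

Lemma leaving0 F : leaving F 0%R = 0.
Proof.
rewrite /leaving (_ : _ `\` _ = set0) ?measure0//; apply/seteqP; split => x //=.
by rewrite /translate/= addr0 => -[].
Qed.

Section set.
Variable F : set T.
Hypothesis mF : measurable F.

Let mFv v : measurable (F `\` translate v F).
Proof. by apply: measurableD => //; exact: measurable_translate_set. Qed.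

Lemma le_leaving v : leaving F v <= mu F.
Proof. by apply: le_measure; rewrite ?inE//; exact: subDsetl. Qed.

(** A point that leaves under [v + w] either leaves under [v], or its image under [v] is a point of
    [F] leaving under [w]. *)
Lemma leavingD v w : leaving F (v + w)%R <= leaving F v + leaving F w.
Proof.
rewrite -[leaving F w](leb_translate v)//.
apply: (le_trans _ (measureU2 _ _ _)) => //; last exact: measurable_translate_set.
apply: le_measure; rewrite ?inE//.
  by apply: measurableU => //; exact: measurable_translate_set.
move=> x [Fx /= nF]; have [Fxv|Fxv] := pselect (F (x + v)%R).
  by right; split => //=; rewrite /translate/= -addrA.
by left.
Qed.

Lemma measurable_leaving_fun : measurable_fun setT (leaving F).
Proof.
pose f (z : T * T) := (\1_F z.1 * \1_(~` F) (z.1 + z.2)%R)%:E : \bar R.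
rewrite (_ : leaving F = fun v => \int[mu]_y f (y, v)).
  apply: measurable_integral1.
    apply/measurable_EFinP; apply: measurable_funM.
      by apply: (measurableT_comp (measurable_indic mF)); exact: measurable_fst.
    apply: (measurableT_comp (measurable_indic (measurableC mF))).
    by apply: measurable_fun_rVD; [exact: measurable_fst|exact: measurable_snd].
  by move=> z; rewrite lee_fin mulr_ge0.
apply/funext => v; rewrite /leaving -[F `\` _]setIT -integral_indic//.
apply: eq_integral => y _; rewrite /f/= !indicE in_setD in_setC.
by rewrite -natrM mulnb.
Qed.

Hypothesis Foo : mu F < +oo.

Let Ffin : mu F \is a fin_num.
Proof. by rewrite ge0_fin_numE. Qed.

Lemma leaving_fin v : leaving F v \is a fin_num.
Proof. by rewrite ge0_fin_numE ?leaving_ge0// (le_lt_trans (le_leaving v)). Qed.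

Lemma leaving_setI v : leaving F v = mu F - mu (F `&` translate v F).
Proof. by rewrite /leaving measureD//; exact: measurable_translate_set. Qed.

Lemma leb_setI_translate v : mu (F `&` translate v F) = mu F - leaving F v.
Proof.
rewrite leaving_setI fin_num_oppeB//; last first.
  rewrite ge0_fin_numE// (le_lt_trans _ Foo)// le_measure ?inE//.
    by apply: measurableI => //; exact: measurable_translate_set.
by rewrite addeA subee// add0e.
Qed.

Lemma leb_setU_translate v : mu (F `|` translate v F) = mu F + leaving F v.
Proof.
have mFt := measurable_translate_set v mF.
by rewrite [LHS]measureUfinl// leb_translate// leaving_setI addeA.
Qed.

Lemma leavingN v : leaving F (- v)%R = leaving F v.
Proof.
rewrite !leaving_setI -[mu (F `&` translate (- v) F)](leb_translate v); last first.
  by apply: measurableI => //; exact: measurable_translate_set.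
rewrite setIC; congr (_ - mu _); apply/seteqP; split => x;
  by rewrite /translate/= addrK.
Qed.

Lemma integral_setI_translate :
  \int[mu]_z mu (F `&` translate z F) = mu F * mu F.
Proof.
pose f (z : T * T) := (\1_F z.1)%:E * (\1_F (z.1 + z.2)%R)%:E : \bar R.
have mf : measurable_fun setT f.
  apply: emeasurable_funM; apply/measurable_EFinP.
    by apply: (measurableT_comp (measurable_indic mF)); exact: measurable_fst.
  apply: (measurableT_comp (measurable_indic mF)).
  by apply: measurable_fun_rVD; [exact: measurable_fst|exact: measurable_snd].
have f0 z : 0 <= f z by rewrite mule_ge0// lee_fin.
transitivity (\int[mu]_z \int[mu]_y f (y, z)).
  apply: eq_integral => z _; rewrite -[F `&` _]setIT -integral_indic//; last first.
    by apply: measurableI => //; exact: measurable_translate_set.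
  by apply: eq_integral => y _; rewrite /f/= -EFinM !indicE in_setI -natrM mulnb.
rewrite -(integral_swap mf f0).
transitivity (\int[mu]_y ((\1_F y)%:E * mu F)).
  apply: eq_integral => y _; rewrite /f/=.
  have mFy : measurable_fun setT (fun z : T => (\1_F (y + z)%R)%:E : \bar R).
    apply/measurable_EFinP; apply: (measurableT_comp (measurable_indic mF)).
    by apply: measurable_fun_rVD => //; exact: measurable_cst.
  rewrite ge0_integralZl//.
  congr (_ * _); rewrite -(leb_translate y)// -[translate _ _]setIT -integral_indic//.
    by apply: eq_integral => z _; rewrite !indicE addrC.
  exact: measurable_translate_set.
rewrite ge0_integralZr//; first by rewrite integral_indic// setIT.
exact/measurable_EFinP/measurable_indic.
Qed.

(** Integrate [|F| = leaving F z + |F]&[translate z F|] over the cube and bound the intersection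
    term by its integral over the whole space, which is [|F| ^ 2]. Once the cube has volume at least
    [2 |F|], the mean of [leaving F] over it is at least [|F| / 2]. *)
Lemma le_leaving_cube (a : R) :
  mu (@cube R N a) * mu F <=
  \int[mu]_z (leaving F z * (\1_(@cube R N a) z)%:E) + mu F * mu F.
Proof.
have mQ := @measurable_cube R N a.
have mI : measurable_fun setT (fun z => mu (F `&` translate z F)).
  under eq_fun do rewrite leb_setI_translate.
  by apply: emeasurable_funB => //; exact: measurable_leaving_fun.
have mQ1 : measurable_fun setT (fun z : T => (\1_(@cube R N a) z)%:E : \bar R).
  exact/measurable_EFinP/measurable_indic.
have mlQ : measurable_fun setT (fun z : T => leaving F z * (\1_(@cube R N a) z)%:E).
  by apply: emeasurable_funM => //; exact: measurable_leaving_fun.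
rewrite -integral_setI_translate -ge0_integralD//; last first.
  by move=> z _; rewrite mule_ge0 ?leaving_ge0// lee_fin.
have -> : mu (@cube R N a) * mu F = \int[mu]_z ((\1_(@cube R N a) z)%:E * mu F).
  by rewrite ge0_integralZr// integral_indic// setIT.
apply: ge0_le_integral => //.
- by apply: emeasurable_funM => //; exact: measurable_cst.
- by apply: emeasurable_funD.
move=> z _; rewrite indicE; case: (z \in @cube R N a).
  by rewrite mule1 mul1e leb_setI_translate addeC subeK// leaving_fin.
by rewrite mule0 mul0e add0e.
Qed.

End set.
End leaving.

(** * Consequences of the lower bound on the kernel *)

Section lower_kernel.
Context {R : realType} (N : nat).
Local Open Scope ereal_scope.
Local Notation T := 'rV[R]_N.
Local Notation mu := (@borel_lebesgue R N : {measure set T -> \bar R}).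
Variables (K : T -> R) (s : R).
Hypotheses (N_gt0 : (0 < N)%N) (s01 : (0 < s < 1)%R).
Hypotheses (mK : measurable_fun setT K) (K0 : forall x, (0 <= K x)%R).
Hypothesis K_ge : forall x, x != 0%R -> (enorm x `^ (- (N%:R + s)) <= K x)%R.

Let mk : measurable_fun setT (EFin \o K).
Proof. exact/measurable_EFinP. Qed.

Let k0 x : 0 <= (EFin \o K) x.
Proof. by rewrite lee_fin. Qed.

Let p : R := (N%:R + s)%R.

Let p_gt0 : (0 < p)%R.
Proof. by case/andP: s01 => s0 _; rewrite /p ltr_wpDl. Qed.

Let NR_gt0 : (0 < N%:R :> R)%R.
Proof. by rewrite ltr0n. Qed.

Section set.
Variable F : set T.
Hypotheses (mF : measurable F) (Foo : mu F < +oo).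

Lemma crossing_leaving :
  crossing (EFin \o K) F = \int[mu]_z ((K z)%:E * leaving F z).
Proof. exact: pair_energy_covariogram. Qed.

(** For [0 < |z| <= r] the lower bound on [K] gives [1 <= r ^ p * K z]. At [z = 0] nothing is known
    of [K] from below, but nothing leaves either. *)
Lemma leaving_le_kernel (r : R) z : (0 <= r)%R -> (enorm z <= r)%R ->
  leaving F z <= (r `^ p)%:E * ((K z)%:E * leaving F z).
Proof.
move=> r0 zr; have [->|z0] := eqVneq z 0%R.
  by rewrite leaving0 !mule0.
rewrite muleA -EFinM -[leLHS]mul1e; apply: lee_wpmul2r; first exact: leaving_ge0.
have ez : (0 < enorm z)%R by rewrite enorm_gt0.
rewrite lee_fin (le_trans _ (ler_wpM2l (powR_ge0 _ _) (K_ge z0)))//.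
rewrite -[leLHS](@mulfV _ (enorm z `^ p)%R); last first.
  by rewrite lt0r_neq0// powR_gt0.
rewrite -/p powRN; apply: ler_wpM2r; first by rewrite invr_ge0 powR_ge0.
by apply: ge0_ler_powR => //; rewrite ?nnegrE// ltW.
Qed.

Lemma integral_leaving_le (r : R) (A : set T) : (0 <= r)%R -> measurable A ->
  (forall z, A z -> (enorm z <= r)%R) ->
  \int[mu]_z (leaving F z * (\1_A z)%:E) <= (r `^ p)%:E * crossing (EFin \o K) F.
Proof.
move=> r0 mA Ar.
have ml := measurable_leaving_fun mF.
have mKl : measurable_fun setT (fun z => (K z)%:E * leaving F z).
  by apply: emeasurable_funM.
rewrite crossing_leaving -ge0_integralZl//; last 2 first.
- by move=> z _; rewrite mule_ge0 ?leaving_ge0// lee_fin.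
- by rewrite lee_fin powR_ge0.
apply: ge0_le_integral => //.
- by move=> z _; rewrite mule_ge0 ?leaving_ge0// lee_fin.
- by apply: emeasurable_funM => //; exact/measurable_EFinP/measurable_indic.
- by apply: emeasurable_funM => //; exact: measurable_cst.
move=> z _; rewrite indicE; case: (boolP (z \in A)) => [/set_mem Az|_].
  by rewrite mule1; apply: leaving_le_kernel => //; exact: Ar.
by rewrite mule0 !mule_ge0 ?leaving_ge0// lee_fin ?powR_ge0.
Qed.

(** Average [leaving F w <= leaving F z + leaving F (w - z)] over [z] in the cube of half-side
    [|w|]. The cube and its translate lie in the ball of radius [(N + 1) |w|], so both integrals are
    bounded by [((N + 1) |w|) ^ (N + s)] times the perimeter; dividing by the volume [(2 |w|) ^ N]
    leaves [|w| ^ s]. *)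
Lemma leaving_holder w :
  leaving F w <= (2 * (N.+1%:R `^ p) / 2 ^+ N * enorm w `^ s)%:E *
    crossing (EFin \o K) F.
Proof.
have P0 := crossing_ge0 k0 F.
have [->|w0] := eqVneq w 0%R.
  by rewrite leaving0 mule_ge0// lee_fin !mulr_ge0 ?invr_ge0 ?powR_ge0 ?exprn_ge0.
set a := enorm w.
have a0 : (0 < a)%R by rewrite /a enorm_gt0.
have mQ := @measurable_cube R N a.
have mQ1 := measurable_indic mQ.
have ml := measurable_leaving_fun mF.
have lw0 := leaving_ge0 F.
have mlw : measurable_fun setT (fun z : T => leaving F (z - w)%R).
  exact: (measurable_translate ml).
pose Q' : set T := [set z | cube a (z + w)%R].
have mQ' : measurable Q' by exact: measurable_rV_preim.
set r : R := (N.+1%:R * a)%R.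
have r0 : (0 <= r)%R by rewrite mulr_ge0// ltW.
have Qr (z : T) : cube a z -> (enorm z <= r)%R.
  move=> zQ; apply: (le_trans (enorm_cube (ltW a0) zQ)).
  by apply: ler_wpM2r; [exact: ltW|rewrite ler_nat].
have Q'r (z : T) : Q' z -> (enorm z <= r)%R.
  move=> zQ; have zw := enorm_cube (ltW a0) zQ.
  have := enormD (z + w)%R (- w)%R; rewrite addrK enormN => /le_trans; apply.
  by rewrite /r -natr1 mulrDl mul1r lerD2r.
have key : mu (@cube R N a) * leaving F w <= 2%:E * ((r `^ p)%:E * crossing (EFin \o K) F).
  have -> : mu (@cube R N a) * leaving F w =
      \int[mu]_z ((\1_(@cube R N a) z)%:E * leaving F w).
    rewrite ge0_integralZr//; first by rewrite integral_indic// setIT.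
    exact/measurable_EFinP.
  apply: (@le_trans _ _ (\int[mu]_z (leaving F z * (\1_(@cube R N a) z)%:E) +
     \int[mu]_z (leaving F (z - w)%R * (\1_(@cube R N a) z)%:E))).
    rewrite -ge0_integralD//; last 4 first.
    - by move=> z _; rewrite mule_ge0// lee_fin.
    - by apply: emeasurable_funM => //; exact/measurable_EFinP.
    - by move=> z _; rewrite mule_ge0// lee_fin.
    - by apply: emeasurable_funM => //; exact/measurable_EFinP.
    apply: ge0_le_integral => //.
    - by move=> z _; rewrite mule_ge0// lee_fin.
    - by apply: emeasurable_funM => //; exact/measurable_EFinP.
    - by apply: emeasurable_funD; apply: emeasurable_funM => //; exact/measurable_EFinP.
    move=> z _; rewrite -ge0_muleDl// muleC; apply: lee_wpmul2r; first by rewrite lee_fin.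
    rewrite -(leavingN mF Foo (z - w)%R) opprB.
    have {1}-> : w = (z + (w - z))%R by rewrite addrC subrK.
    exact: leavingD.
  rewrite -[2%R]/(1 + 1)%R EFinD ge0_muleDl// !mul1e; apply: leeD.
    exact: integral_leaving_le.
  rewrite -(@ge0_integral_shift _ _ w); last 2 first.
  - by apply: emeasurable_funM => //; exact/measurable_EFinP.
  - by move=> z; rewrite mule_ge0// lee_fin.
  rewrite (eq_integral (fun z => leaving F z * (\1_Q' z)%:E)).
    exact: integral_leaving_le.
  by move=> z _; rewrite addrK.
move: key; rewrite (borel_lebesgue_cube _ (ltW a0)) => key.
have a2 : (0 < (2 * a) ^+ N)%R by rewrite exprn_gt0// mulr_gt0.
rewrite -(@lee_pmul2l _ ((2 * a) ^+ N)%:E)//.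
apply: (le_trans key); rewrite !muleA -!EFinM.
apply: lee_wpmul2r => //; rewrite lee_fin le_eqVlt; apply/orP; left; apply/eqP.
have -> : (r `^ p = N.+1%:R `^ p * (a ^+ N * a `^ s))%R.
  rewrite /r powRM//; last exact: ltW.
  congr (_ * _)%R; rewrite /p powRD; last by rewrite (lt0r_neq0 a0) implybT.
  by rewrite powR_mulrn//; exact: ltW.
rewrite exprMn; set x := (_ `^ _)%R; set y := (_ `^ _)%R; field.
by rewrite expf_neq0.
Qed.

End set.

(** Over a cube of volume [2 v] the integral of [leaving F] is at least [v ^ 2], and it is at most
    [(N a) ^ (N + s)] times the perimeter, where the half-side [a] is of order [v ^ (1 / N)]. The
    exponent is [2 - (N + s) / N = 1 - s / N]. *)
Lemma isoperimetric : exists2 c : R, (0 < c)%R & forall F (v : R), measurable F ->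
  (0 < v)%R -> mu F = v%:E ->
  (c * v `^ (1 - s / N%:R))%:E <= crossing (EFin \o K) F.
Proof.
exists (((N%:R / 2) `^ p * 2 `^ (p / N%:R))^-1)%R.
  by rewrite invr_gt0 mulr_gt0// powR_gt0// divr_gt0.
move=> F v mF v0 Fv.
have Foo : mu F < +oo by rewrite Fv ltry.
(* [b] is the side of the cube of volume [2 v], and [a] its half-side. *)
pose b : R := ((2 * v) `^ (N%:R^-1))%R; pose a : R := (b / 2)%R.
have b0 : (0 < b)%R by rewrite powR_gt0// mulr_gt0.
have a0 : (0 < a)%R by rewrite divr_gt0.
have aN : ((2 * a) ^+ N = 2 * v)%R.
  rewrite /a mulrCA mulfV ?mulr1//.
  by rewrite -powR_mulrn ?powR_ge0// -powRrM mulVf ?powRr1 ?lt0r_neq0 ?mulr_ge0 ?ltW.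
have r0 : (0 <= N%:R * a)%R by rewrite mulr_ge0// ltW.
have mQ := @measurable_cube R N a.
have Qr (z : T) : cube a z -> (enorm z <= N%:R * a)%R.
  by move=> zQ; exact: (enorm_cube (ltW a0) zQ).
have /(_ a) := le_leaving_cube mF Foo.
rewrite (borel_lebesgue_cube _ (ltW a0)) aN Fv -!EFinM => key.
have {key}key : (v * v)%:E <= ((N%:R * a) `^ p)%:E * crossing (EFin \o K) F.
  apply: le_trans (integral_leaving_le mF r0 mQ Qr).
  rewrite -(@leeD2rE _ (v * v)%:E)// -EFinD.
  by rewrite (_ : v * v + v * v = 2 * v * v)%R//; ring.
have ap0 : (0 < (N%:R * a) `^ p)%R by rewrite powR_gt0// mulr_gt0.
rewrite -(@lee_pmul2l _ ((N%:R * a) `^ p)%:E)//.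
apply: le_trans key; rewrite -EFinM lee_fin le_eqVlt; apply/orP; left; apply/eqP.
have -> : ((N%:R * a) `^ p = (N%:R / 2) `^ p * 2 `^ (p / N%:R) * v `^ (p / N%:R))%R.
  rewrite /a mulrA mulrAC powRM ?divr_ge0 ?powR_ge0// -mulrA; congr (_ * _)%R.
  by rewrite /b -powRrM [(N%:R^-1 * p)%R]mulrC powRM// ltW.
have -> : (v `^ (1 - s / N%:R) = v * v * v `^ (- (p / N%:R)))%R.
  rewrite -{2}(powRr1 (ltW v0)) -{3}(powRr1 (ltW v0)) -!powRD ?(lt0r_neq0 v0) ?implybT//.
  by congr (_ `^ _)%R; rewrite /p; field; rewrite lt0r_neq0.
rewrite powRN; have := powR_gt0 (p / N%:R) v0; set y := (v `^ _)%R => y0.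
have x0 : (0 < (N%:R / 2) `^ p :> R)%R by rewrite powR_gt0// divr_gt0.
have z0 : (0 < 2 `^ (p / N%:R) :> R)%R by rewrite powR_gt0.
by field; rewrite !lt0r_neq0.
Qed.

(** By subadditivity two values differ by at most [leaving F] at the difference of the translations,
    which the Hoelder bound controls when the perimeter is finite. This feeds the intermediate value
    theorem that prescribes the exchanged volume. *)
Lemma leaving_continuous F (w : T) : measurable F -> mu F < +oo ->
  crossing (EFin \o K) F < +oo ->
  continuous (fun t : R => fine (leaving F (t *: w))).
Proof.
move=> mF Foo Poo t.
have P0 := crossing_ge0 k0 F.
have Pfin : crossing (EFin \o K) F \is a fin_num by rewrite ge0_fin_numE.
pose C : R := (2 * (N.+1%:R `^ p) / 2 ^+ N * enorm w `^ s *
  fine (crossing (EFin \o K) F))%R.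
have C0 : (0 <= C)%R.
  by rewrite !mulr_ge0 ?invr_ge0 ?powR_ge0 ?exprn_ge0 ?fine_ge0.
have holder (x y : R) :
    (fine (leaving F (x *: w)) - fine (leaving F (y *: w)) <= C * `|x - y| `^ s)%R.
  have lf := leaving_fin mF Foo.
  have := leavingD mF (y *: w)%R ((x - y) *: w)%R.
  rewrite -scalerDl subrKC.
  rewrite -(fineK (lf (x *: w)%R)) -(fineK (lf (y *: w)%R)).
  rewrite -(fineK (lf ((x - y) *: w)%R)) -EFinD lee_fin -lerBlDl => /le_trans; apply.
  rewrite -lee_fin fineK//; apply: (le_trans (leaving_holder mF Foo _)).
  rewrite -(fineK Pfin) -EFinM lee_fin enormZ powRM ?enorm_ge0// /C.
  by rewrite le_eqVlt; apply/orP; left; apply/eqP; ring.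
apply/cvgrPdist_le => e e0.
have [s0 _] := andP s01.
pose d : R := ((e / (C + 1)) `^ s^-1)%R.
have eC : (0 < e / (C + 1))%R by rewrite divr_gt0// ltr_wpDl.
have d0 : (0 < d)%R by rewrite powR_gt0.
near=> y.
have ty : (C * `|t - y| `^ s <= e)%R.
  have : (`|t - y| <= d)%R.
    by near: y; exact: (@cvgr_dist_le _ _ _ (nbhs t) _ id t _ _ d0).
  move=> /(ge0_ler_powR (ltW s0) (normr_ge0 _) (ltW d0)).
  rewrite /d -powRrM mulVf ?lt0r_neq0// (powRr1 (ltW eC)) => tye.
  apply: (le_trans (ler_wpM2l C0 tye)).
  rewrite mulrCA -[leRHS]mulr1; apply: ler_wpM2l; first exact: ltW.
  by rewrite ler_pdivrMr ?mul1r ?lerDl// ltr_wpDl.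
rewrite ler_norml lerNl opprB; apply/andP; split.
  by rewrite (le_trans (holder _ _))// distrC.
by rewrite (le_trans (holder _ _)).
Unshelve. all: by end_near. Qed.

Lemma leaving_mulrn F (w : T) n : measurable F ->
  leaving F (w *+ n) <= n%:R%:E * leaving F w.
Proof.
move=> mF; elim: n => [|n IH]; first by rewrite mulr0n leaving0 mul0e.
rewrite mulrS -nat1r EFinD ge0_muleDl ?lee_fin// mul1e.
by apply: (le_trans (leavingD mF _ _)); exact: leeD2l.
Qed.

(* Half of [F] leaves under some [w0] in a fixed cube, on average over the cube.
   Subadditivity of [leaving F] then gives [leaving F (w0 / n) >= d] for
   [n ~ leaving F w0 / d], and continuity along the segment from 0 to [w0 / n]
   an exact value. *)
Lemma exact_gain (M : R) : (0 < M)%R -> exists2 C : R, (0 < C)%R &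
  forall F (v d : R), measurable F -> mu F = v%:E -> (M / 2 <= v <= M)%R ->
    crossing (EFin \o K) F < +oo -> (0 < d <= M / 4)%R ->
    exists2 w : T, leaving F w = d%:E & (enorm w <= C * d)%R.
Proof.
(* This gives [(2 * L) ^ N >= 2 * L > 2 * M >= 2 * v]: the cube is large enough for [leaving F] to
   have mean at least [v / 2] on it. *)
move=> M0; pose L : R := (M + 1)%R.
have L0 : (0 < L)%R by rewrite addr_gt0.
(* Here [|w0| <= N * L], and [1 / n <= 8 * d / M] because [n + 1 > leaving F w0 / d >= M / (4 * d)]
   and [n + 1 <= 2 * n]. *)
exists (8 * N%:R * L / M)%R; first by rewrite divr_gt0// !mulr_gt0.
move=> F v d mF Fv /andP[Mv vM] Poo /andP[d0 dM].
have Foo : mu F < +oo by rewrite Fv ltry.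
have v0 : (0 < v)%R by rewrite (lt_le_trans _ Mv)// divr_gt0.
have LN : (2 * M < (2 * L) ^+ N)%R.
  have L1 : (1 <= 2 * L)%R by rewrite /L; lra.
  by apply: (lt_le_trans _ (ler_eXnr N_gt0 L1)); rewrite /L; lra.
have mQ := @measurable_cube R N L.
have [w0 Lw0 gw0] : exists2 w0 : T, cube L w0 & (v / 2)%:E <= leaving F w0.
  apply: contrapT => none.
  have /(_ L) := le_leaving_cube mF Foo.
  rewrite (borel_lebesgue_cube _ (ltW L0)) Fv -!EFinM; apply/negP.
  rewrite -ltNge; apply: (@le_lt_trans _ _ ((v / 2 * (2 * L) ^+ N + v * v)%:E)).
    rewrite EFinD; apply: leeD2r.
    apply: (@le_trans _ _ (\int[mu]_z ((v / 2)%:E * (\1_(@cube R N L) z)%:E))).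
      apply: ge0_le_integral => //.
      - by move=> z _; rewrite mule_ge0 ?leaving_ge0// lee_fin.
      - apply: emeasurable_funM; first exact: measurable_leaving_fun.
        exact/measurable_EFinP/measurable_indic.
      - by apply: emeasurable_funM => //; exact/measurable_EFinP/measurable_indic.
      move=> z _; rewrite indicE; case: (boolP (z \in @cube R N L)) => [/set_mem zL|_].
        rewrite !mule1 leNgt; apply/negP => zv; apply: none; exists z => //.
        exact: ltW.
      by rewrite !mule0.
    rewrite ge0_integralZl//; last 2 first.
    - exact/measurable_EFinP/measurable_indic.
    - by rewrite lee_fin divr_ge0// ltW.
    by rewrite integral_indic// setIT (borel_lebesgue_cube _ (ltW L0)) -EFinM.
  rewrite lte_fin; set X := ((2 * L) ^+ N)%R in LN *.
  have : (0 < v * (X - 2 * v))%R by rewrite mulr_gt0// subr_gt0; lra.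
  by rewrite mulrBr; lra.
have gf := leaving_fin mF Foo.
pose g (w : T) : R := fine (leaving F w).
have gE w : leaving F w = (g w)%:E by rewrite /g fineK.
have g0 : (v / 2 <= g w0)%R by rewrite -lee_fin -gE.
have gd : (0 <= g w0 / d)%R by rewrite divr_ge0 ?fine_ge0 ?leaving_ge0// ltW.
pose n := Num.truncn (g w0 / d)%R.
have nlt : (g w0 / d < n.+1%:R)%R := truncnS_gt (g w0 / d)%R.
have nle : (n%:R <= g w0 / d)%R by rewrite /n truncn_le.
have n0 : (0 < n)%N by rewrite truncn_gt0 ler_pdivlMr// mul1r; lra.
have nR0 : (0 < n%:R :> R)%R by rewrite ltr0n.
have gn : (d <= g (n%:R^-1 *: w0))%R.
  rewrite -(ler_pM2l nR0); apply: (@le_trans _ _ (g w0)).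
    by rewrite -ler_pdivlMr.
  rewrite -lee_fin EFinM -!gE.
  have -> : leaving F w0 = leaving F ((n%:R^-1 *: w0) *+ n)%R.
    by rewrite -scaler_nat scalerA mulfV ?scale1r// lt0r_neq0.
  exact: leaving_mulrn.
have [t t01 gt] : exists2 t : R, t \in `[0%R, n%:R^-1]%R & g (t *: w0) = d.
  apply: (@IVT R (fun t => g (t *: w0)) 0%R (n%:R^-1)%R d).
  - by rewrite invr_ge0 ltW.
  - apply: continuous_subspaceT; exact: (leaving_continuous mF Foo Poo).
  - have -> : g (0 *: w0) = 0%R by rewrite /g scale0r leaving0.
    have gn0 : (0 <= g (n%:R^-1 *: w0))%R by rewrite fine_ge0 ?leaving_ge0.
    by rewrite min_l// max_r// (ltW d0) gn.
exists (t *: w0); first by rewrite gE gt.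
rewrite enormZ; move: t01; rewrite in_itv/= => /andP[t0 tn].
rewrite (ger0_norm t0).
apply: (@le_trans _ _ (n%:R^-1 * (N%:R * L))%R).
  by apply: ler_pM => //; [exact: enorm_ge0|exact: enorm_cube (ltW L0) Lw0].
have : (n%:R^-1 <= 8 * d / M)%R.
  rewrite -[(8 * d / M)%R]invrK lef_pV2 ?posrE ?invr_gt0 ?divr_gt0 ?mulr_gt0//.
  rewrite invf_div ler_pdivrMr ?mulr_gt0//.
  have n1 : (n.+1%:R <= 2 * n%:R :> R)%R.
    by rewrite -natr1 mulr_natl mulr2n lerD2l ler1n.
  move: nlt; rewrite ltr_pdivrMr// => nlt.
  have : (n.+1%:R * d <= 2 * n%:R * d)%R by rewrite ler_wpM2r// ltW.
  by rewrite mulrCA; lra.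
move=> /(ler_wpM2r (_ : 0 <= N%:R * L)%R) => /(_ _)/le_trans; apply.
  by rewrite mulr_ge0// ltW.
by rewrite le_eqVlt; apply/orP; left; apply/eqP; ring.
Qed.

End lower_kernel.

(** * Bounds on the Coulomb and attraction terms *)

Section newton_bounds.
Context {R : realType} (N : nat).
Local Open Scope ereal_scope.
Local Notation T := 'rV[R]_N.
Local Notation mu := (@borel_lebesgue R N : {measure set T -> \bar R}).
Hypothesis N_ge2 : (2 <= N)%N.

(** Within distance one of [y] the singular majorant dominates; further away the kernel is at most
    one and contributes at most [v]. In [H] the added one only ensures positivity. *)
Lemma newton_potential_bound : exists2 H : R, (0 < H)%R &
  forall (A : set T) (v : R), measurable A -> mu A = v%:E ->
  forall y, \int[mu]_x (newton (x - y)%R * (\1_A x)%:E) <= (H + v)%:E.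
Proof.
have [|h [mh h0 hy hz hoo]] := @singular_majorant R N 1.
  by rewrite ler01 ltr1n.
have Hfin : \int[mu]_x h x \is a fin_num by rewrite ge0_fin_numE// integral_ge0.
exists (fine (\int[mu]_x h x) + 1)%R.
  by rewrite ltr_wpDl// fine_ge0// integral_ge0.
move=> A v mA Av y.
have mA1 : measurable_fun setT (fun x : T => (\1_A x)%:E : \bar R).
  exact/measurable_EFinP/measurable_indic.
have mhy := measurable_translate mh y.
apply: (@le_trans _ _ (\int[mu]_x (h (x - y)%R + (\1_A x)%:E))).
  apply: ge0_le_integral => //.
  - by move=> x _; rewrite mule_ge0 ?newton_ge0// lee_fin.
  - exact: (measurable_potential (@measurable_newton R N)).
  - by apply: emeasurable_funD.
  move=> x _; rewrite indicE; case: (x \in A); last by rewrite mule0 adde0.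
  rewrite mule1; set z := (x - y)%R.
  have [->|z0] := eqVneq z 0%R; first by rewrite hy addye// leey.
  rewrite /newton inver enorm_eq0 (negbTE z0).
  have ez : (0 < enorm z)%R by rewrite enorm_gt0.
  have [z1|z1] := ltP (enorm z) 1%R.
    apply: (@le_trans _ _ (h z)); last by rewrite leeDl.
    by have := hz z; rewrite powR_inv1 ?enorm_ge0//; apply; rewrite ez.
  rewrite (@le_trans _ _ 1)// ?leeDr// lee_fin.
  by rewrite invf_le1.
rewrite ge0_integralD// integral_indic// setIT Av.
rewrite (ge0_integral_shift (- y)%R mh h0) -(fineK Hfin) -EFinD lee_fin; lra.
Qed.

Lemma newton_mutual_bound : exists2 H : R, (0 < H)%R &
  forall (A B : set T) (u v : R), measurable A -> measurable B ->
  mu A = u%:E -> mu B = v%:E ->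
  mutual (@newton R N) A B <= ((H + u) * v)%:E.
Proof.
have [H H0 HA] := newton_potential_bound.
exists H => // A B u v mA mB Au Bv; rewrite EFinM -Bv.
apply: le_mutual_cst => //.
- exact: measurable_newton.
- exact: newton_ge0.
- exact: HA.
Qed.

Lemma nuclear_bound : exists2 H : R, (0 < H)%R &
  forall (A : set T) (v : R), measurable A -> mu A = v%:E ->
  nuclear A <= (H + v)%:E.
Proof.
have [H H0 HA] := newton_potential_bound.
exists H => // A v mA Av; apply: le_trans (HA A v mA Av 0%R).
by rewrite /nuclear; under [leRHS]eq_integral do rewrite subr0.
Qed.

(** Interpolating with [b < 1] keeps the error integrable: the choice [b = 1] would produce
    [|x| ^ -2], which is not integrable at the origin of the plane. When [x = w] the right-hand side
    is infinite. *)
Lemma newton_shift (b : R) (x w : T) : (0 < b < 1)%R -> x != 0%R ->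
  newton x <= newton (x - w)%R + (enorm w `^ b * enorm x `^ (- (1 + b)))%:E.
Proof.
move=> /andP[b0 b1] x0; rewrite /newton.
have [xw|xw] := eqVneq (x - w)%R 0%R.
  by rewrite xw enorm0 inve0 addye// leey.
rewrite !inver !enorm_eq0 (negbTE x0) (negbTE xw) -EFinD lee_fin.
have {}x0 : (0 < enorm x)%R by rewrite enorm_gt0.
have {}xw : (0 < enorm (x - w))%R by rewrite enorm_gt0.
have tri : (enorm (x - w) <= enorm x + enorm w)%R by rewrite -(enormN w) enormD.
set a := enorm x in x0 tri *; set c := enorm (x - w) in xw tri *.
set d := enorm w in tri *.
have d0 : (0 <= d)%R by exact: enorm_ge0.
have P0 : (0 <= d `^ b * a `^ (- (1 + b)))%R by rewrite mulr_ge0 ?powR_ge0.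
have [ca|ac] := leP c a.
  by rewrite (@le_trans _ _ c^-1)%R ?lef_pV2 ?posrE// lerDl.
(* [1/a - 1/c = (c-a)/(ac)] with [c - a <= min d c <= d^b c^(1-b)] *)
have ca0 : (0 < c - a)%R by rewrite subr_gt0.
have h1 : (c - a <= d `^ b * c `^ (1 - b))%R.
  rewrite -{1}(powRr1 (ltW ca0)) -{1}(subrKC b 1) powRD; last first.
    by rewrite lt0r_neq0 ?implybT.
  apply: ler_pM; rewrite ?powR_ge0//.
    apply: (ge0_ler_powR (ltW b0) (ltW ca0) d0); rewrite lerBlDl.
    exact: tri.
  apply: (ge0_ler_powR _ (ltW ca0) (ltW xw)); first by rewrite subr_ge0 ltW.
  by rewrite gerBl ltW.
have h2 : (c `^ (- b) <= a `^ (- b))%R.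
  rewrite !powRN lef_pV2 ?posrE ?powR_gt0//.
  by apply: (ge0_ler_powR (ltW b0) (ltW x0) (ltW xw)); exact: ltW.
rewrite -lerBlDl; have -> : (a^-1 - c^-1 = (c - a) * (c^-1 * a^-1))%R.
  by field; rewrite !lt0r_neq0.
have -> : (d `^ b * a `^ (- (1 + b)) = d `^ b * (a^-1 * a `^ (- b)))%R.
  rewrite opprD powRD; last by rewrite (lt0r_neq0 x0) implybT.
  by rewrite powR_inv1//; exact: ltW.
apply: (@le_trans _ _ (d `^ b * c `^ (1 - b) * (c^-1 * a^-1)))%R.
  by apply: ler_wpM2r => //; rewrite mulr_ge0 ?invr_ge0 ?ltW.
rewrite -!mulrA; apply: ler_wpM2l; first exact: powR_ge0.
rewrite powRD; last by rewrite (lt0r_neq0 xw) implybT.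
rewrite (powRr1 (ltW xw)) mulrA -[X in (X * _)%R]mulrA [X in (_ * X * _)%R]mulrC.
rewrite mulrA (mulfV (lt0r_neq0 xw)) mul1r mulrC.
by apply: ler_wpM2l => //; rewrite invr_ge0 ltW.
Qed.

Lemma nuclear_shift (b : R) : (0 < b < 1)%R -> exists2 H : R, (0 < H)%R &
  forall (A : set T) (v : R) (w : T), measurable A -> mu A = v%:E ->
  nuclear A <= nuclear (translate w A) + (enorm w `^ b * (H + v))%:E.
Proof.
move=> b01; have /andP[b0 b1] := b01.
have [|h [mh h0 hy hz hoo]] := @singular_majorant R N (1 + b)%R.
  rewrite addr_ge0 ?ler01 ?ltW//=; apply: (@lt_le_trans _ _ 2%:R); first by rewrite ltrD2l.
  by rewrite ler_nat.
have Hfin : \int[mu]_x h x \is a fin_num by rewrite ge0_fin_numE// integral_ge0.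
exists (fine (\int[mu]_x h x) + 1)%R.
  by rewrite ltr_wpDl// fine_ge0// integral_ge0.
move=> A v w mA Av.
have mA1 : measurable_fun setT (fun x : T => (\1_A x)%:E : \bar R).
  exact/measurable_EFinP/measurable_indic.
(* The pointwise comparison at [x = 0] below uses [|w| ^ b * +oo = +oo], which requires [w] to be
   nonzero. *)
have [w0|w0] := eqVneq w 0%R.
  rewrite w0 (_ : translate 0 A = A).
    rewrite leeDl// lee_fin mulr_ge0 ?powR_ge0//.
    have v0 : (0 <= v)%R by rewrite -lee_fin -Av measure_ge0.
    by rewrite !addr_ge0// fine_ge0// integral_ge0.
  by apply/seteqP; split => x; rewrite /translate/= addr0.
have mn := @measurable_newton R N.
have n0 := @newton_ge0 R N.
have mnw := measurable_translate mn w.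
have -> : nuclear (translate w A) = \int[mu]_x (newton (x - w)%R * (\1_A x)%:E).
  pose f (x : T) := newton (x - w)%R * (\1_A x)%:E.
  have mf : measurable_fun setT f by exact: measurable_potential.
  have f0 x : 0 <= f x by rewrite mule_ge0// lee_fin.
  rewrite -[RHS](ge0_integral_shift w mf f0).
  by apply: eq_integral => x _; rewrite /f addrK.
have db0 : (0 <= enorm w `^ b)%R by exact: powR_ge0.
apply: (@le_trans _ _ (\int[mu]_x (newton (x - w)%R * (\1_A x)%:E +
    (enorm w `^ b)%:E * (h x + (\1_A x)%:E)))).
  apply: ge0_le_integral => //.
  - by move=> x _; rewrite mule_ge0// lee_fin.
  - exact: emeasurable_funM.
  - apply: emeasurable_funD; first exact: emeasurable_funM.
    by apply: emeasurable_funM => //; exact: emeasurable_funD.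
  move=> x _; rewrite indicE; case: (x \in A); last first.
    by rewrite !mule0 add0e mule_ge0// ?lee_fin// adde_ge0// lee_fin.
  rewrite !mule1; have [->|x0] := eqVneq x 0%R.
    rewrite hy addye// gt0_muley ?lte_fin ?powR_gt0 ?enorm_gt0// addey ?leey//.
    by rewrite gt_eqF// (lt_le_trans _ (n0 _)).
  apply: (le_trans (newton_shift w b01 x0)); apply: leeD2l.
  rewrite EFinM; apply: lee_wpmul2l; first by rewrite lee_fin.
  have ez : (0 < enorm x)%R by rewrite enorm_gt0.
  have [z1|z1] := ltP (enorm x) 1%R.
    apply: (@le_trans _ _ (h x)); last by rewrite leeDl.
    by apply: hz; rewrite ez.
  rewrite (@le_trans _ _ 1)// ?leeDr// lee_fin.
  rewrite -[leRHS](powRr0 (enorm x)); apply: ler_powR => //.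
  by rewrite lerNl oppr0 addr_ge0// ltW.
have mh1 : measurable_fun setT (fun x : T => h x + (\1_A x)%:E).
  exact: emeasurable_funD.
have h10 x : 0 <= h x + (\1_A x)%:E by rewrite adde_ge0// lee_fin.
rewrite ge0_integralD//; last 4 first.
- by move=> x _; rewrite mule_ge0// lee_fin.
- exact: emeasurable_funM.
- by move=> x _; rewrite mule_ge0// lee_fin.
- exact: emeasurable_funM.
apply: leeD2l; rewrite ge0_integralZl// ge0_integralD// integral_indic// setIT Av.
rewrite -(fineK Hfin) -EFinD -EFinM lee_fin; apply: ler_wpM2l => //; lra.
Qed.

End newton_bounds.

(** * Kernels with a singularity of order N + s *)

Section upper_kernel.
Context {R : realType} (N : nat).
Local Open Scope ereal_scope.
Local Notation T := 'rV[R]_N.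
Local Notation mu := (@borel_lebesgue R N : {measure set T -> \bar R}).
Variables (K : T -> R) (s lambda : R).
Hypotheses (N_gt0 : (0 < N)%N) (s01 : (0 < s < 1)%R).
Hypotheses (mK : measurable_fun setT K) (K0 : forall x, (0 <= K x)%R).
Hypothesis lambda0 : (0 < lambda)%R.
Hypothesis K_le : forall x, (0 < enorm x < 1)%R ->
  (K x <= lambda * enorm x `^ (- (N%:R + s)))%R.

Let D : set T := ~` eball 0 1.

Let DE x : D x = (1 <= enorm x)%R :> Prop.
Proof. by apply/propext; rewrite /D/= eball0E leNgt; split => /negP. Qed.

Let mD : measurable D.
Proof. by apply: measurableC; exact: measurable_eball0. Qed.

Let mk : measurable_fun setT (EFin \o K).
Proof. exact/measurable_EFinP. Qed.

(** The one quantity through which [K] enters the upper bounds: it controls the perimeter of any set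
    whose [leaving] is Lipschitz and bounded, and the interaction across a sphere averaged over
    radii. *)
Definition weighted_mass := \int[mu]_z (K z * Num.min (enorm z) 1)%:E.

Let mKw : measurable_fun setT (fun z => (K z * Num.min (enorm z) 1)%:E).
Proof.
apply/measurable_EFinP; apply: measurable_funM => //.
by apply: measurable_minr => //; exact: measurable_enorm.
Qed.

(** Near the origin the factor [|z|] lowers the singularity to order [N + s - 1 < N]; away from it
    [K] itself is integrable. *)
Lemma weighted_mass_finite :
  \int[mu]_x ((K x)%:E * (\1_D x)%:E) < +oo -> weighted_mass < +oo.
Proof.
move=> Koo; have /andP[s0 s1] := s01.
have [|h [mh h0 hy hz hoo]] := @singular_majorant R N (N%:R + s - 1)%R.
  apply/andP; split; last by lra.
  have : (1 <= N%:R :> R)%R by rewrite ler1n.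
  lra.
have mD1 : measurable_fun setT (fun x : T => (\1_D x)%:E : \bar R).
  exact/measurable_EFinP/measurable_indic.
apply: (@le_lt_trans _ _ (\int[mu]_x (lambda%:E * h x + (K x)%:E * (\1_D x)%:E))).
  apply: ge0_le_integral => //.
  - by move=> z _; rewrite lee_fin mulr_ge0// le_min enorm_ge0 ler01.
  - by apply: emeasurable_funD; apply: emeasurable_funM.
  move=> z _; have [->|z0] := eqVneq z 0%R.
    rewrite enorm0 min_l// mulr0 adde_ge0// mule_ge0//; rewrite lee_fin//.
    exact: ltW.
  have ez : (0 < enorm z)%R by rewrite enorm_gt0.
  have [z1|z1] := ltP (enorm z) 1%R.
    apply: (@le_trans _ _ (lambda%:E * h z)); last by rewrite leeDl// mule_ge0// lee_fin.
    apply: (@le_trans _ _ (lambda%:E * (enorm z `^ (- (N%:R + s - 1)))%:E)).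
      rewrite -EFinM lee_fin.
      have -> : (- (N%:R + s - 1) = - (N%:R + s) + 1)%R by ring.
      rewrite powRD; last by rewrite (lt0r_neq0 ez) implybT.
      rewrite (powRr1 (ltW ez)) mulrA; apply: ler_wpM2r; first exact: ltW.
      by apply: K_le; rewrite ez.
    by apply: lee_wpmul2l; [rewrite lee_fin ltW|apply: hz; rewrite ez].
  rewrite mulr1 indicE mem_set ?mule1; last by rewrite DE.
  by rewrite leeDr// mule_ge0// lee_fin ltW.
rewrite ge0_integralD//; last 4 first.
- by move=> z _; rewrite mule_ge0// lee_fin ltW.
- exact: emeasurable_funM.
- by move=> z _; rewrite mule_ge0// lee_fin.
- by apply: emeasurable_funM.
rewrite ge0_integralZl//; last by rewrite lee_fin ltW.
rewrite lte_add_pinfty// lte_mul_pinfty//; first by rewrite lee_fin ltW.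
Qed.

Lemma crossing_lipschitz (F : set T) (C : R) : measurable F -> (0 <= C)%R ->
  (forall z, leaving F z <= (C * Num.min (enorm z) 1)%:E) ->
  crossing (EFin \o K) F <= C%:E * weighted_mass.
Proof.
move=> mF C0 FC; rewrite crossing_leaving// -ge0_integralZl//; last first.
  by move=> z _; rewrite lee_fin mulr_ge0// le_min enorm_ge0 ler01.
apply: ge0_le_integral => //.
- by move=> z _; rewrite mule_ge0 ?leaving_ge0// lee_fin.
- by apply: emeasurable_funM => //; exact: measurable_leaving_fun.
- by apply: emeasurable_funM => //; exact: measurable_cst.
move=> z _; apply: (@le_trans _ _ ((K z)%:E * (C * Num.min (enorm z) 1)%:E)).
  by apply: lee_wpmul2l => //; rewrite lee_fin.
by rewrite -!EFinM mulrCA.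
Qed.

End upper_kernel.

(** * Cubes as competitors of finite perimeter *)

Section cube_leaving.
Context {R : realType} (N : nat).
Local Open Scope ereal_scope.
Local Notation T := 'rV[R]_N.
Local Notation mu := (@borel_lebesgue R N : {measure set T -> \bar R}).

Let slab (a c d : R) (i : 'I_N) : set T :=
  [set y : T | forall j, y ord0 j \in (if j == i then `[c, d] else `[- a, a])%R].

Let measurable_slab a c d i : measurable (slab a c d i).
Proof.
apply: (rV_measurable_set (P := fun j => [set` (if j == i then `[c, d] else `[- a, a])%R])) => j.
exact: measurable_itv.
Qed.

Let leb_slab a c d i : (0 <= a)%R -> (c <= d)%R ->
  mu (slab a c d i) = ((2 * a) ^+ N.-1 * (d - c))%:E.
Proof.
move=> a0 cd.
pose u : T := \row_j (if j == i then c else - a)%R.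
pose v : T := \row_j (if j == i then d else a)%R.
have -> : slab a c d i = [set x | forall j, x ord0 j \in `[u ord0 j, v ord0 j]%R].
  by apply/seteqP; split => z /= za j; have := za j; rewrite !mxE; case: ifP.
rewrite [LHS](@borel_lebesgue_box R N u v) => [|j]; last by rewrite !mxE; case: ifP => // _; lra.
rewrite (bigD1 i)//= !mxE eqxx mulrC; congr (_ * _)%:E.
rewrite (eq_bigr (fun=> 2 * a)%R) => [|j /negbTE ji]; last by rewrite !mxE ji; lra.
by rewrite prodr_const; congr (_ ^+ _)%R; rewrite cardC1 card_ord.
Qed.

(** A point pushed out of the cube by [z] crosses a face orthogonal to some axis [i], hence lies in
    one of two slabs of thickness [|z_i|] along those faces. For [|z| > 1] the volume of the cube is
    a better bound, whence the maximum. *)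
Lemma cube_leaving (a : R) : (0 < a)%R -> exists2 C : R, (0 <= C)%R &
  forall z : T, leaving (@cube R N a) z <= (C * Num.min (enorm z) 1)%:E.
Proof.
move=> a0.
pose A := ((2 * a) ^+ N.-1)%R.
have A0 : (0 <= A)%R by rewrite exprn_ge0// mulr_ge0// ltW.
exists (Num.max (N%:R * (2 * A)) ((2 * a) ^+ N))%R.
  by rewrite le_max mulr_ge0//= mulr_ge0.
move=> z.
have h1 : leaving (@cube R N a) z <= ((N%:R * (2 * A)) * enorm z)%:E.
  pose S i : set T := slab a (- a) (- a + `|z ord0 i|) i `|` slab a (a - `|z ord0 i|) a i.
  have mS i : measurable (S i) by apply: measurableU; exact: measurable_slab.
  have boole (r : seq 'I_N) : mu (\big[setU/set0]_(i <- r) S i) <= \sum_(i <- r) mu (S i).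
    elim: r => [|i r IH]; first by rewrite !big_nil measure0.
    rewrite !big_cons; apply: (le_trans (measureU2 _ _ _)) => //.
      by apply: bigsetU_measurable => j _.
    exact: leeD2l.
  apply: (@le_trans _ _ (mu (\big[setU/set0]_(i < N) S i))).
    apply: le_measure; rewrite ?inE.
    - apply: measurableD; first exact: measurable_cube.
      by apply: measurable_translate_set; exact: measurable_cube.
    - by apply: bigsetU_measurable => j _.
    move=> y [yQ /= nyQ]; rewrite -bigcup_seq.
    have /existsNP[i yzi] := nyQ; exists i; first by rewrite /= mem_index_enum.
    have yi : forall j, (- a <= y ord0 j <= a)%R by move=> j; have := yQ j; rewrite in_itv.
    have /andP[yi1 yi2] := yi i.
    move: yzi => /negP; rewrite in_itv/= !mxE negb_and -!ltNge => /orP[yz|yz].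
      left => j; case: ifPn => [/eqP ->|_]; rewrite in_itv/=; last exact: yi.
      by rewrite yi1/=; have := ler_norm (- z ord0 i)%R; rewrite normrN; lra.
    right => j; case: ifPn => [/eqP ->|_]; rewrite in_itv/=; last exact: yi.
    by rewrite yi2 andbT; have := ler_norm (z ord0 i); lra.
  apply: (le_trans (boole _)).
  apply: (@le_trans _ _ (\sum_(i < N) (2 * A * enorm z)%:E)).
    apply: lee_sum => i _.
    have zi : (0 <= `|z ord0 i|)%R by [].
    have : mu (S i) <= mu (slab a (- a) (- a + `|z ord0 i|) i) +
        mu (slab a (a - `|z ord0 i|) a i).
      by apply: measureU2; exact: measurable_slab.
    move=> /le_trans; apply.
    have le1 : (- a <= - a + `|z ord0 i|)%R by rewrite lerDl.
    have le2 : (a - `|z ord0 i| <= a)%R by rewrite gerBl.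
    rewrite (leb_slab i (ltW a0) le1) (leb_slab i (ltW a0) le2).
    rewrite -EFinD lee_fin -/A.
    have := coord_le_enorm z i; set x := `|_|%R => xz.
    have : (A * x <= A * enorm z)%R by exact: ler_wpM2l.
    by rewrite (_ : - a + x - - a = x)%R; [lra|ring].
  by rewrite sumEFin sumr_const card_ord lee_fin -[X in (X <= _)%R]mulr_natl !mulrA lexx.
have h2 : leaving (@cube R N a) z <= ((2 * a) ^+ N)%:E.
  by rewrite -(borel_lebesgue_cube _ (ltW a0)); apply: le_leaving; exact: measurable_cube.
have [z1|z1] := leP (enorm z) 1%R.
  apply: (le_trans h1); rewrite lee_fin; apply: ler_wpM2r; first exact: enorm_ge0.
  by rewrite le_max lexx.
by apply: (le_trans h2); rewrite lee_fin mulr1 le_max lexx orbT.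
Qed.

End cube_leaving.

(** * Interaction across a sphere, averaged over its radius *)

Section averaging.
Context {R : realType} (N : nat).
Local Open Scope ereal_scope.
Local Notation T := 'rV[R]_N.
Local Notation lam := (@borel_lebesgue R N).
Local Notation mu := (@borel_lebesgue R N : {measure set T -> \bar R}).
Variables (K : T -> R).
Hypotheses (mK : measurable_fun setT K) (K0 : forall x, (0 <= K x)%R).

Let mk : measurable_fun setT (EFin \o K).
Proof. exact/measurable_EFinP. Qed.

Let minK0 (z : T) : (0 <= Num.min (enorm z) 1)%R.
Proof. by rewrite le_min enorm_ge0 ler01. Qed.

Let mmin : measurable_fun setT (fun z : T => Num.min (enorm z) 1)%R.
Proof. by apply: measurable_minr => //; exact: measurable_enorm. Qed.

Lemma pair_energy_min (B : set T) : measurable B ->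
  pair_energy (EFin \o K)
    (fun z => \1_B z.2 * Num.min (enorm (z.1 - z.2)) 1)%R =
  mu B * weighted_mass K.
Proof.
move=> mB.
have mB1 : measurable_fun setT (fun y : T => (\1_B y)%:E : \bar R).
  exact/measurable_EFinP/measurable_indic.
have mKm : measurable_fun setT (fun z : T => (K z * Num.min (enorm z) 1)%:E).
  by apply/measurable_EFinP; apply: measurable_funM.
rewrite pair_energy_fubini//; last 2 first.
- apply: measurable_funM.
    by apply: (measurableT_comp (measurable_indic mB)); exact: measurable_snd.
  apply: (measurableT_comp mmin).
  by apply: measurable_fun_rVB; [exact: measurable_fst|exact: measurable_snd].
- by move=> z; rewrite mulr_ge0.
have -> : mu B = \int[mu]_y (\1_B y)%:E by rewrite integral_indic// setIT.
rewrite -ge0_integralZr//; last first.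
  by apply: integral_ge0 => z _; rewrite lee_fin mulr_ge0.
apply: eq_integral => y _ /=.
rewrite /weighted_mass -(ge0_integral_shift (- y)%R mKm) => [|z]; last first.
  by rewrite lee_fin mulr_ge0.
rewrite -ge0_integralZl//; last 2 first.
- exact: (measurable_translate mKm).
- by move=> z _; rewrite lee_fin mulr_ge0.
by apply: eq_integral => x _; rewrite -!EFinM; congr EFin; ring.
Qed.

(** Integrate the interaction over [r] in [[a, a + l]] and exchange the integrals: a pair
    contributes only if [y] lies outside the ball of radius [a], and in proportion to the length of
    the set of radii separating [x] from [y], at most [min(|x - y|, 1)]. The total is at most
    [kappa * phi]. If the bound failed at every radius the total would be at least
    [2 * kappa * phi]; the factor two makes the contradiction strict. *)
Lemma averaging_cut (kappa a l phi : R) (E : set T) :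
  weighted_mass K <= kappa%:E -> (0 < kappa)%R -> measurable E ->
  (0 < l <= 1)%R -> (0 < phi)%R -> mu (E `\` eball 0 a) = phi%:E ->
  exists2 r : R, (a <= r <= a + l)%R &
    mutual (EFin \o K) (E `&` eball 0 r) (E `\` eball 0 r) <=
      (2 * kappa * phi / l)%:E.
Proof.
move=> wk kappa0 mE /andP[l0 l1] phi0 Ephi; apply: contrapT => none.
pose RT : measurableType _ := measurableTypeR R.
pose b (p : RT * (T * T)) := [&& (enorm p.2.1 < p.1)%R, (p.1 <= enorm p.2.2)%R,
  (a <= p.1)%R & (p.1 <= a + l)%R].
pose S : set (RT * (T * T)) := [set p | b p].
have m1 : measurable_fun setT (fun p : RT * (T * T) => p.1 : R) by exact: measurable_fst.
have m21 : measurable_fun setT (fun p : RT * (T * T) => p.2.1).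
  by apply: (measurableT_comp (@measurable_fst _ _ T T)); exact: measurable_snd.
have m22 : measurable_fun setT (fun p : RT * (T * T) => p.2.2).
  by apply: (measurableT_comp (@measurable_snd _ _ T T)); exact: measurable_snd.
have me1 : measurable_fun setT (fun p : RT * (T * T) => enorm p.2.1).
  by apply: (measurableT_comp (@measurable_enorm R N)).
have me2 : measurable_fun setT (fun p : RT * (T * T) => enorm p.2.2).
  by apply: (measurableT_comp (@measurable_enorm R N)).
have mb : measurable_fun setT b.
  apply: measurable_and; first exact: measurable_fun_ltr.
  apply: measurable_and; first exact: measurable_fun_ler.
  by apply: measurable_and; apply: measurable_fun_ler.
have mS : measurable S.
  rewrite (_ : S = b @^-1` [set true])//.
  by rewrite -[X in measurable X]setTI; exact: mb.
pose f (p : RT * (T * T)) : \bar R :=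
  (K (p.2.1 - p.2.2)%R)%:E * (rect E E p.2 * \1_S p)%:E.
have mf : measurable_fun setT f.
  apply: emeasurable_funM; apply/measurable_EFinP.
    by apply: (measurableT_comp mK); exact: measurable_fun_rVB.
  apply: measurable_funM; last exact: measurable_indic.
  by apply: (measurableT_comp (measurable_rect mE mE)); exact: measurable_snd.
have f0 p : 0 <= f p by rewrite mule_ge0 ?lee_fin// mulr_ge0 ?rect_ge0.
pose I : set RT := [set` `[a, a + l]%R].
have mI : measurable I by exact: measurable_itv.
(* The library's sigma-finite instance for products is shadowed by the one for
   subprobabilities and cannot be inferred. *)
have sf := isSigmaFinite.sigma_finiteT
  (lebesgue_integral_fubini.measure_function_Measure_isSigmaFinite__to__measure_function_isSigmaFinite
    lam lam).
pose mm : {sigma_finite_measure set (T * T)%type -> \bar R} :=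
  HB.pack (lam \x lam)%E
    (Measure_isSigmaFinite.Build _ _ _ (lam \x lam)%E sf).
pose J (r : RT) : \bar R := \int[(lam \x lam)%E]_z f (r, z).
pose G (z : T * T) : \bar R := @integral _ RT R lebesgue_measure setT (fun r => f (r, z)).
have lI : lebesgue_measure I = l%:E.
  rewrite /I lebesgue_measure_itv/= lte_fin ltrDl l0 -EFinB; congr EFin; ring.
have lower : (2 * kappa * phi)%:E <= \int[lebesgue_measure]_r J r.
  apply: (@le_trans _ _ (\int[lebesgue_measure]_r
      ((2 * kappa * phi / l)%:E * (\1_I r)%:E))).
    rewrite ge0_integralZl//; last 2 first.
    - exact/measurable_EFinP/measurable_indic.
    - by rewrite lee_fin divr_ge0 ?mulr_ge0// ltW.
    rewrite integral_indic// setIT [X in _ * X]lI -EFinM lee_fin.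
    by rewrite divfK ?lt0r_neq0.
  apply: ge0_le_integral => //.
  - by move=> r _; rewrite mule_ge0// lee_fin// divr_ge0 ?mulr_ge0// ltW.
  - by apply: emeasurable_funM => //; exact/measurable_EFinP/measurable_indic.
  - exact: (@measurable_fun_fubini_tonelli_F _ _ RT (T * T)%type R mm f mf f0).
  move=> r _; rewrite indicE; case: (boolP (r \in I)) => [/set_mem Ir|_]; last first.
    by rewrite mule0 integral_ge0.
  rewrite mule1 leNgt; apply/negP => lt_c; apply: none; exists r.
    by move: Ir; rewrite /I/= in_itv.
  apply: le_trans (ltW lt_c); rewrite /mutual /pair_energy.
  rewrite le_eqVlt; apply/orP; left; apply/eqP; apply: eq_integral => -[x y] _.
  rewrite /f/= /rect/=; congr (_ * _%:E).
  have -> : \1_S (r, (x, y)) = (b (r, (x, y)))%:R :> R.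
    by rewrite indicE; congr (nat_of_bool _)%:R; apply/idP/idP; rewrite inE.
  move: Ir; rewrite /I/= in_itv/= /b/= => ->; rewrite andbT.
  rewrite !indicE in_setI in_setD.
  have inB (v : T) : (v \in eball 0 r) = (enorm v < r)%R.
    by apply/idP/idP; rewrite inE eball0E.
  rewrite !inB -leNgt.
  by case: (x \in E); case: (y \in E); case: (_ < r)%R; case: (r <= _)%R;
    rewrite /= ?(mulr1, mulr0, mul0r).
have upper : \int[(lam \x lam)%E]_z G z <= (kappa * phi)%:E.
  apply: (@le_trans _ _ (pair_energy (EFin \o K)
      (fun z => \1_(E `\` eball 0 a) z.2 * Num.min (enorm (z.1 - z.2)) 1)%R)); last first.
    rewrite pair_energy_min ?Ephi; last first.
      by apply: measurableD => //; exact: measurable_eball0.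
    by rewrite muleC EFinM; apply: lee_wpmul2r => //; rewrite lee_fin ltW.
  apply: ge0_le_integral => //.
  - by move=> z _; apply: integral_ge0.
  - exact: (@measurable_fun_fubini_tonelli_G _ _ RT (T * T)%type R lebesgue_measure f mf f0).
  - apply: measurable_pair_integrand => //; apply: measurable_funM.
      have mEa : measurable (E `\` eball 0 a).
        by apply: measurableD => //; exact: measurable_eball0.
      by apply: (measurableT_comp (measurable_indic mEa)); exact: measurable_snd.
    apply: (measurableT_comp mmin).
    by apply: measurable_fun_rVB; [exact: measurable_fst|exact: measurable_snd].
  move=> [x y] _ /=.
  pose Sz : set RT := [set r | b (r, (x, y))].
  have mSz : measurable Sz.
    have := @pair2_measurable _ _ RT (T * T)%type (x, y) measurableT S mS.
    by rewrite setTI.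
  have -> : G (x, y) = (K (x - y) * rect E E (x, y))%:E * lebesgue_measure Sz.
    rewrite /G -[Sz]setIT -integral_indic// -ge0_integralZl//; last 2 first.
    - exact/measurable_EFinP/measurable_indic.
    - by rewrite lee_fin mulr_ge0 ?rect_ge0.
    apply: eq_integral => r _; rewrite /f/= -!EFinM mulrA; congr (_ * _)%:E.
  have itvE (u v : R) : (u <= v)%R ->
      lebesgue_measure ([set` `[u, v]%R] : set RT) = (v - u)%:E.
    move=> uv; rewrite lebesgue_measure_itv/= lte_fin; case: ltP => [_|vu].
      by rewrite -EFinB.
    by rewrite (@le_anti _ _ u v) ?subrr// uv.
  rewrite EFinM -muleA; apply: lee_wpmul2l; first by rewrite lee_fin.
  have [yE|nyE] := boolP (y \in E `\` eball 0 a); last first.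
    rewrite [in leRHS]indicE (negbTE nyE) mul0r.
    move: nyE; rewrite in_setD negb_and negbK => /orP[yE|yB].
      by rewrite /rect/= [\1_E y]indicE (negbTE yE) mulr0 mul0e.
    rewrite (_ : Sz = set0) ?measure0 ?mule0//.
    apply/seteqP; split => // r /and4P[_ /= ry ar _].
    by move: yB; rewrite inE eball0E ltNge (le_trans ar ry).
  rewrite [in leRHS]indicE yE mul1r -[leRHS]mul1e.
  apply: lee_pmul => //; first by rewrite lee_fin rect_ge0.
    by rewrite lee_fin /rect mulr_ile1// indicE lern1 leq_b1.
  (* Separating radii lie both in the window, of length [l <= 1], and between [|x|] and [|y|]; the
     two estimates give the two entries of the minimum. *)
  have le1 : lebesgue_measure Sz <= 1.
    apply: (@le_trans _ _ l%:E); last by rewrite lee_fin.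
    rewrite -lI; apply: le_measure; rewrite ?inE// => r /and4P[_ _ ar ra].
    by rewrite /I/= in_itv/= ar.
  have le2 : lebesgue_measure Sz <= (enorm (x - y))%:E.
    have [xy|yx] := leP (enorm x) (enorm y); last first.
      rewrite (_ : Sz = set0) ?measure0 ?lee_fin ?enorm_ge0//.
      apply/seteqP; split => // r /and4P[/= xr ry _ _].
      by have := lt_trans (lt_le_trans xr ry) yx; rewrite ltxx.
    apply: (@le_trans _ _ (enorm y - enorm x)%:E); last first.
      by rewrite lee_fin (le_trans (lerB_enorm y x))// -opprB enormN.
    rewrite -itvE//; apply: le_measure; rewrite ?inE// => r /and4P[/= xr ry _ _].
    by rewrite /= in_itv/= ltW.
  by have [] := leP (enorm (x - y)) 1%R.
have := le_trans lower (le_trans _ upper).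
have := @fubini_tonelli _ _ RT (T * T)%type R lebesgue_measure mm f mf f0.
rewrite -/J -/G => -> /(_ (lexx _)); rewrite lee_fin.
have : (0 < kappa * phi)%R by rewrite mulr_gt0.
lra.
Qed.

End averaging.

(** Along [x_k = a + 1 - 2 ^ -k] one shows [f (x_k) <= e * q ^ k]. The step of length [2 ^ -(k + 1)]
    costs a factor [2 * C * 2 ^ k], and the power [al < 1] on the left turns smallness of [f] into
    enough gain to absorb it. Monotonicity then gives [f (a + 1) = 0]. *)
Lemma de_giorgi (R : realType) (f : R -> R) (C h al : R) :
  (forall x, 0 <= f x) -> (forall x y, x <= y -> f y <= f x) ->
  0 < C -> 0 < h -> 0 < al < 1 ->
  (forall a l, 1 <= a -> 0 < l <= 1 -> f a <= h ->
    f (a + l) `^ al <= C / l * f a) ->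
  (forall e, 0 < e -> exists2 a, 1 <= a & f a <= e) ->
  exists2 a, 1 <= a & f a = 0.
Proof.
move=> f0 fni C0 h0 /andP[al0 al1] fstep fcvg.
have c0 : 0 < 1 - al by rewrite subr_gt0.
(* Chosen so that [q ^ (1 - al) = 1 / 2], which cancels the growing factor [2 ^ k]. *)
pose q : R := 2 `^ (- (1 - al)^-1).
have q0 : 0 < q by rewrite powR_gt0.
have q1 : q < 1.
  rewrite /q powRN invf_lt1 ?powR_gt0// /powR pnatr_eq0/= expR_gt1.
  by rewrite mulr_gt0 ?invr_gt0// ln_gt0// ltr1n.
(* Largest value with [2 * C * e1 ^ (1 - al) <= q ^ al], which absorbs the constant left in the
   induction step. *)
pose e1 : R := (q `^ al / (2 * C)) `^ (1 - al)^-1.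
have e10 : 0 < e1 by rewrite powR_gt0// divr_gt0 ?powR_gt0// mulr_gt0.
pose e : R := Num.min h e1.
have e0 : 0 < e by rewrite lt_min h0.
have eh : e <= h by rewrite ge_min lexx.
have ee : 2 * C * e `^ (1 - al) <= q `^ al.
  rewrite mulrC -ler_pdivlMr ?mulr_gt0//.
  have : e `^ (1 - al) <= e1 `^ (1 - al).
    by apply: (ge0_ler_powR (ltW c0) (ltW e0) (ltW e10)); rewrite ge_min lexx orbT.
  move=> /le_trans; apply; rewrite /e1 -powRrM mulVf ?lt0r_neq0// powRr1//.
  by rewrite divr_ge0 ?powR_ge0// mulr_ge0// ltW.
have [a a1 fa] := fcvg e e0.
pose x (k : nat) : R := a + 1 - 2^-1 ^+ k.
have xS k : x k.+1 = x k + 2^-1 ^+ k.+1 by rewrite /x exprS; lra.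
have hk k : 0 < (2^-1 : R) ^+ k <= 1.
  by rewrite exprn_gt0//= exprn_ile1// invf_le1// ler1n.
have x1 k : 1 <= x k by rewrite /x; have /andP[] := hk k; lra.
have key k : f (x k) <= e * q ^+ k.
  elim: k => [|k IH]; first by rewrite /x !expr0 mulr1 addrK.
  have qk0 : 0 < q ^+ k by rewrite exprn_gt0.
  have fh : f (x k) <= h.
    apply: (le_trans IH); apply: (le_trans _ eh); apply: ler_piMr; first exact: ltW.
    by apply: exprn_ile1; exact: ltW.
  have := fstep _ _ (x1 k) (hk k.+1) fh; rewrite -xS => step.
  have step2 : f (x k.+1) `^ al <= (e * q ^+ k.+1) `^ al.
    apply: (le_trans step).
    have -> : C / 2^-1 ^+ k.+1 = 2 * C * 2 ^+ k.
      by rewrite exprVn invrK exprS; ring.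
    have t0 : 0 <= 2 * C * 2 ^+ k by rewrite !mulr_ge0 ?exprn_ge0// ltW.
    apply: (le_trans (ler_wpM2l t0 IH)).
    have eE : e = e `^ al * e `^ (1 - al).
      rewrite -powRD; last by rewrite (lt0r_neq0 e0) implybT.
      by rewrite subrKC powRr1// ltW.
    have qE : q ^+ k = (q ^+ k) `^ al * 2^-1 ^+ k.
      rewrite -[2^-1](_ : q `^ (1 - al) = _); last first.
        by rewrite /q -powRrM mulNr mulVf ?lt0r_neq0// powR_inv1.
      rewrite -[(q `^ (1 - al)) ^+ k]powR_mulrn ?powR_ge0// powRAC powR_mulrn ?ltW//.
      rewrite -powRD; last by rewrite (lt0r_neq0 qk0) implybT.
      by rewrite subrKC powRr1// ltW.
    rewrite exprSr mulrA (powRM _ (ltW (mulr_gt0 e0 qk0)) (ltW q0)).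
    rewrite (powRM _ (ltW e0) (ltW qk0)).
    rewrite {1}eE {1}qE.
    have -> : 2 * C * 2 ^+ k * (e `^ al * e `^ (1 - al) * ((q ^+ k) `^ al * 2^-1 ^+ k)) =
      e `^ al * (q ^+ k) `^ al * (2 * C * e `^ (1 - al)).
      rewrite exprVn; field; by rewrite expf_neq0.
    by apply: ler_wpM2l => //; rewrite mulr_ge0 ?powR_ge0.
  rewrite leNgt; apply/negP => lt; move: step2; apply/negP; rewrite -ltNge.
  by apply: gt0_ltr_powR => //; rewrite nnegrE// mulr_ge0 ?exprn_ge0 ?ltW.
exists (a + 1); first by lra.
apply/eqP; rewrite eq_le f0 andbT.
apply/ler_addgt0Pr => d d0; rewrite add0r.
have [k kd] : exists k : nat, e * q ^+ k <= d.
  have : (e * q ^+ k @[k --> \oo] --> 0).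
    rewrite -[X in _ --> X](mulr0 e); apply: cvgMr.
    by apply: cvg_expr; rewrite ger0_norm ?ltW.
  move=> /cvgrPdist_le/(_ d d0)[k _ /(_ k (leqnn k))].
  rewrite sub0r normrN ger0_norm; last by rewrite mulr_ge0 ?exprn_ge0 ?ltW.
  by exists k.
apply: le_trans kd; apply: le_trans (key k); apply: fni.
by rewrite /x; have /andP[] := hk k; lra.
Qed.

(** * Almost concavity of the energy profile *)

Section profile.
Context {R : realType} (N : nat).
Local Open Scope ereal_scope.
Local Notation T := 'rV[R]_N.
Local Notation mu := (@borel_lebesgue R N : {measure set T -> \bar R}).
Variables (K : T -> R) (s A : R).
Hypotheses (N_ge2 : (2 <= N)%N) (s01 : (0 < s < 1)%R) (A0 : (0 <= A)%R).
Hypotheses (mK : measurable_fun setT K) (K0 : forall x, (0 <= K x)%R).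
Hypothesis K_ge : forall x, x != 0%R -> (enorm x `^ (- (N%:R + s)) <= K x)%R.

Let mk : measurable_fun setT (EFin \o K).
Proof. exact/measurable_EFinP. Qed.

Let k0 x : 0 <= (EFin \o K) x.
Proof. by rewrite lee_fin. Qed.

Let N_gt0 : (0 < N)%N.
Proof. exact: ltnW. Qed.

Definition borel_energy (F : set T) : \bar R :=
  crossing (EFin \o K) F + (2^-1)%:E * mutual (@newton R N) F F - A%:E * nuclear F.

Let mn := @measurable_newton R N.
Let n0 := @newton_ge0 R N.

Lemma nuclear_ge0 (F : set T) : 0 <= nuclear F :> \bar R.
Proof. by apply: integral_ge0 => x _; rewrite mule_ge0// lee_fin. Qed.

Lemma nuclear_setUI (F G : set T) : measurable F -> measurable G ->
  nuclear (F `|` G) + nuclear (F `&` G) = nuclear F + nuclear G :> \bar R.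
Proof.
move=> mF mG.
have mi (D : set T) : measurable D ->
    measurable_fun setT (fun x => newton x * (\1_D x)%:E).
  by move=> mD; apply: emeasurable_funM => //; exact/measurable_EFinP/measurable_indic.
have i0 (D : set T) x : 0 <= newton x * (\1_D x)%:E.
  by rewrite mule_ge0// lee_fin.
have mU := measurableU _ _ mF mG; have mI := measurableI _ _ mF mG.
rewrite /nuclear.
rewrite -(ge0_integralD mu measurableT (fun x _ => i0 _ x) (mi _ mU)
  (fun x _ => i0 _ x) (mi _ mI)).
rewrite -(ge0_integralD mu measurableT (fun x _ => i0 _ x) (mi _ mF)
  (fun x _ => i0 _ x) (mi _ mG)).
apply: eq_integral => x _; rewrite -!ge0_muleDr ?lee_fin//; congr (_ * _).
rewrite -!EFinD; congr EFin; rewrite !indicE in_setU in_setI.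
by case: (x \in F); case: (x \in G); rewrite /= ?(addr0, add0r).
Qed.

(** At finite volume only the perimeter can be infinite. This turns energy inequalities into real
    arithmetic, and the bound on the attraction bounds the energy from below. *)
Lemma finite_energy_parts : exists2 H : R, (0 < H)%R &
  forall (F : set T) (v : R), measurable F -> mu F = v%:E ->
  exists V W : R, [/\ mutual (@newton R N) F F = V%:E, nuclear F = W%:E,
    (0 <= V)%R & (0 <= W <= H + v)%R].
Proof.
have [H1 H10 H1P] := @newton_mutual_bound R N N_ge2.
have [H2 H20 H2P] := @nuclear_bound R N N_ge2.
exists H2 => // F v mF Fv.
have V0 := mutual_ge0 n0 F F.
have W0 := nuclear_ge0 F.
have VH := H1P _ _ _ _ mF mF Fv Fv.
have WH := H2P _ _ mF Fv.
have Vf : mutual (@newton R N) F F \is a fin_num.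
  by rewrite ge0_fin_numE// (le_lt_trans VH)// ltry.
have Wf : nuclear F \is a fin_num.
  by rewrite ge0_fin_numE// (le_lt_trans WH)// ltry.
exists (fine (mutual (@newton R N) F F)), (fine (nuclear F)).
rewrite !fineK//; split => //; first exact: fine_ge0.
by rewrite fine_ge0//= -lee_fin fineK.
Qed.

(** The base volume is [m - d] so that the union has exactly the volume [m] of the minimizer and the
    intersection is the set at deficit [2 * d] to which the estimate can be applied again. *)
Lemma concavity_step (b m : R) : (0 < b < 1)%R -> (0 < m)%R ->
  exists2 C : R, (0 < C)%R &
  forall (F : set T) (d : R), measurable F -> mu F = (m - d)%:E ->
  (0 < d <= m / 4)%R -> crossing (EFin \o K) F < +oo ->
  exists U I : set T, [/\ measurable U, measurable I, mu U = m%:E,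
    mu I = (m - 2 * d)%:E &
    borel_energy U + borel_energy I <=
      borel_energy F + borel_energy F + (C * d `^ b)%:E].
Proof.
move=> b01 m0; have /andP[b0 b1] := b01.
have [H1 H10 H1P] := @newton_mutual_bound R N N_ge2.
have [H2 H20 H2P] := @nuclear_shift R N N_ge2 b b01.
have [H3 H30 parts] := finite_energy_parts.
have [Cg Cg0 gain] := exact_gain N_gt0 s01 mK K0 K_ge m0.
(* The first summand bounds the repulsion defect, half of two terms [(H1 + d) * d], through
   [d <= d ^ b * m ^ (1 - b)]; the second bounds the change of attraction under a translation of
   length at most [Cg * d]. *)
pose C := ((H1 + m) * m `^ (1 - b) + A * (Cg `^ b * (H2 + m)))%R.
exists C.
  rewrite ltr_wpDr ?mulr_gt0 ?powR_gt0 ?addr_gt0// mulr_ge0// mulr_ge0 ?powR_ge0//.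
  by rewrite addr_ge0 ?ltW.
move=> F d mF Fv /andP[d0 dm] Poo.
have [w gw ew] : exists2 w : T, leaving F w = d%:E & (enorm w <= Cg * d)%R.
  by apply: (gain F (m - d)%R d) => //; apply/andP; split; lra.
have ewb : (enorm w `^ b <= Cg `^ b * d `^ b)%R.
  rewrite -(powRM _ (ltW Cg0) (ltW d0)).
  by apply: (ge0_ler_powR (ltW b0) (enorm_ge0 w) (ltW (mulr_gt0 Cg0 d0))).
have db : (d <= d `^ b * m `^ (1 - b))%R.
  rewrite -[leLHS](powRr1 (ltW d0)) -[in leLHS](subrKC b 1) powRD; last first.
    by rewrite (lt0r_neq0 d0) implybT.
  apply: ler_wpM2l; first exact: powR_ge0.
  have c0 : (0 <= 1 - b)%R by lra.
  by apply: (ge0_ler_powR c0 (ltW d0) (ltW m0)); lra.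
have Hd : ((H1 + d) * d <= (H1 + m) * m `^ (1 - b) * d `^ b)%R.
  rewrite -mulrA [(m `^ _ * _)%R]mulrC; apply: ler_pM => //; lra.
have RF' : (enorm w `^ b * (H2 + (m - d)) <= Cg `^ b * d `^ b * (H2 + m))%R.
  by apply: ler_pM; rewrite ?powR_ge0//; lra.
have Foo : mu F < +oo by rewrite Fv ltry.
pose G := translate w F.
have mG : measurable G by exact: measurable_translate_set.
have mU := measurableU _ _ mF mG; have mI := measurableI _ _ mF mG.
have Uv : mu (F `|` G) = m%:E by rewrite leb_setU_translate// Fv gw -EFinD subrK.
have Iv : mu (F `&` G) = (m - 2 * d)%:E.
  by rewrite leb_setI_translate// Fv gw -EFinB; congr EFin; ring.
exists (F `|` G), (F `&` G); split => //.
have Gv : mu G = (m - d)%:E by rewrite leb_translate.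
have Goo : mu G < +oo by rewrite Gv ltry.
have mFG := measurableD mF mG; have mGF := measurableD mG mF.
have FGv : mu (F `\` G) = d%:E by [].
have GFv : mu (G `\` F) = d%:E.
  transitivity (mu G - mu (F `&` G)).
    by rewrite setIC; exact: measureD.
  by rewrite Gv Iv -EFinB; congr EFin; ring.
have PU := le_crossingUI mk k0 mF mG.
have VU := le_mutualUI mn n0 mF mG.
have RU := nuclear_setUI mF mG.
have RF := H2P F _ w mF Fv; rewrite -/G in RF.
have X1 := H1P _ _ _ _ mFG mGF FGv GFv.
have X2 := H1P _ _ _ _ mGF mFG GFv FGv.
have PG : crossing (EFin \o K) G = crossing (EFin \o K) F by exact: crossing_shift.
have VG : mutual (@newton R N) G G = mutual (@newton R N) F F by exact: mutual_shift.
have [VFv [RFv [EVF ERF VF0 RF0]]] := parts F _ mF Fv.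
have [VGv [RGv [EVG ERG VG0 RG0]]] := parts G _ mG Gv.
have [VUv [RUv [EVU ERU VU0 RU0]]] := parts _ _ mU Uv.
have [VIv [RIv [EVI ERI VI0 RI0]]] := parts _ _ mI Iv.
have Pf : crossing (EFin \o K) F \is a fin_num by rewrite ge0_fin_numE// crossing_ge0.
rewrite PG -(fineK Pf) in PU; set p := fine _ in PU.
have PUf : crossing (EFin \o K) (F `|` G) \is a fin_num.
  rewrite ge0_fin_numE ?crossing_ge0//.
  by apply: (le_lt_trans _ (le_lt_trans PU (ltry _))); rewrite leeDl// crossing_ge0.
have PIf : crossing (EFin \o K) (F `&` G) \is a fin_num.
  rewrite ge0_fin_numE ?crossing_ge0//.
  by apply: (le_lt_trans _ (le_lt_trans PU (ltry _))); rewrite leeDr// crossing_ge0.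
rewrite -(fineK PUf) -(fineK PIf) -!EFinD lee_fin in PU.
have X : mutual (@newton R N) (F `\` G) (G `\` F) + mutual (@newton R N) (G `\` F) (F `\` G)
    <= ((H1 + d) * d + (H1 + d) * d)%:E by rewrite EFinD; exact: leeD.
have {VU} := le_trans VU (leeD2l _ X).
rewrite VG EVU EVI EVF -!EFinD lee_fin => VU.
rewrite ERU ERI ERF ERG in RU RF.
move: RU RF => [RU]; rewrite -!EFinD lee_fin => RF.
rewrite /borel_energy EVU EVI EVF ERU ERI ERF -(fineK PUf) -(fineK PIf) -(fineK Pf).
rewrite -!EFinM -!EFinN -!EFinD lee_fin -/p.
have AR : (A * RFv <= A * RGv + A * (Cg `^ b * d `^ b * (H2 + m)))%R.
  by rewrite -mulrDr; apply: ler_wpM2l => //; lra.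
have ARU : (A * RUv + A * RIv = A * RFv + A * RGv)%R by rewrite -!mulrDr RU.
have -> : (C * d `^ b = (H1 + m) * m `^ (1 - b) * d `^ b +
    A * (Cg `^ b * d `^ b * (H2 + m)))%R by rewrite /C; ring.
lra.
Qed.

(** Induction on the dyadic scale of [d]. For [d > m / 8] the energy of [F] is at least
    [- A * (H + m)] and [d ^ b] is bounded below. At smaller scales, a bound [g] on the excess of
    the energy of [E] at deficit [d] satisfies [2 g(d) <= g(2 d) + C1 d ^ b], the union being a
    competitor of [E] and the intersection falling under the induction hypothesis. *)
Lemma profile_bound (b m : R) (E : set T) : (0 < b < 1)%R -> (0 < m)%R ->
  measurable E -> mu E = m%:E -> crossing (EFin \o K) E < +oo ->
  (forall U, measurable U -> mu U = m%:E -> borel_energy E <= borel_energy U) ->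
  exists2 C : R, (0 < C)%R & forall (F : set T) (d : R),
    measurable F -> mu F = (m - d)%:E -> (0 < d <= m / 4)%R ->
    borel_energy E <= borel_energy F + (C * d `^ b)%:E.
Proof.
move=> b01 m0 mE Em Poo minE; have /andP[b0 b1] := b01.
have [C1 C10 step] := concavity_step b01 m0.
have [H H0 parts] := finite_energy_parts.
have Pf : crossing (EFin \o K) E \is a fin_num by rewrite ge0_fin_numE// crossing_ge0.
have [e Ee] : exists e : R, borel_energy E = e%:E.
  have [V [W [EV EW _ _]]] := parts E m mE Em.
  rewrite /borel_energy EV EW -(fineK Pf) -!EFinM -!EFinN -!EFinD.
  by eexists; reflexivity.
have b2 : (0 < 2 - 2 `^ b :> R)%R.
  rewrite subr_gt0 -[ltRHS]powRr1//.
  by rewrite /powR pnatr_eq0/= ltr_expR ltr_pM2r// ln_gt0// ltr1n.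
have m8b : (0 < (m / 8) `^ b)%R by rewrite powR_gt0// divr_gt0.
pose D := (`|e| + A * (H + m))%R.
have D0 : (0 <= D)%R by rewrite addr_ge0// mulr_ge0// addr_ge0 ?ltW.
(* The first entry serves the coarsest scale; the second is what [C * 2 ^ b + C1 <= 2 * C] demands
   in the recursion. *)
pose C := Num.max (D / (m / 8) `^ b)%R (C1 / (2 - 2 `^ b))%R.
have CD : (D <= C * (m / 8) `^ b)%R.
  by rewrite -ler_pdivrMr// /C le_max lexx.
have CC1 : (C1 <= C * (2 - 2 `^ b))%R.
  by rewrite -ler_pdivrMr// /C le_max lexx orbT.
have C0 : (0 < C)%R by rewrite lt_max [X in _ || X]divr_gt0// orbT.
exists C => //.
suff main n F d : measurable F -> mu F = (m - d)%:E ->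
    (m / 4 * 2^-1 ^+ n.+1 < d <= m / 4 * 2^-1 ^+ n)%R ->
    borel_energy E <= borel_energy F + (C * d `^ b)%:E.
  move=> F d mF Fv /andP[d0 dm].
  have m4 : (0 < m / 4)%R by rewrite divr_gt0.
  have ex_n : exists n : nat, (m / 4 * 2^-1 ^+ n < d)%R.
    have : (m / 4 * 2^-1 ^+ n @[n --> \oo] --> (0 : R))%R.
      rewrite -[X in (_ --> X)%R](mulr0 (m / 4)%R); apply: cvgMr.
      by apply: cvg_expr; rewrite ger0_norm// invf_lt1// ltr1n.
    move=> /cvgrPdist_lt/(_ d d0)[n _ /(_ n (leqnn n))].
    rewrite sub0r normrN ger0_norm; last by rewrite mulr_ge0 ?exprn_ge0// ltW.
    by exists n.
  case: (ex_minnP ex_n) => -[|n] dn nmin.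
    by move: dn; rewrite expr0 mulr1 ltNge dm.
  apply: (main n) => //; rewrite dn /= leNgt; apply/negP => /nmin.
  by rewrite ltnn.
elim: n F d => [|n IH] F d mF Fv.
  rewrite expr0 expr1 mulr1 => /andP[dl dr].
  have [V [W [EV EW V0 /andP[W0 WH]]]] := parts F _ mF Fv.
  have d8 : (m / 8 <= d)%R by lra.
  have d0 : (0 < d)%R by lra.
  have dd : ((m / 8) `^ b <= d `^ b)%R.
    have m8 : (0 <= m / 8)%R by lra.
    by apply: (ge0_ler_powR (ltW b0) m8 (ltW d0)).
  have Cdd : (D <= C * d `^ b)%R.
    by apply: (le_trans CD); apply: ler_wpM2l => //; exact: ltW.
  have AW : (A * W <= A * (H + m))%R by apply: ler_wpM2l => //; lra.
  rewrite Ee /borel_energy EV EW.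
  apply: (@le_trans _ _ (0 + (2^-1)%:E * V%:E - A%:E * W%:E + (C * d `^ b)%:E)).
    rewrite -!EFinM -!EFinN -!EFinD lee_fin.
    have := ler_norm e; rewrite /D in Cdd; lra.
  by rewrite leeD2r// leeD2r// leeD2r// crossing_ge0.
move=> /andP[dl dr].
have h2 k : (0 < (2^-1 : R) ^+ k <= 1)%R.
  by rewrite exprn_gt0//= exprn_ile1// invf_le1// ler1n.
have d0 : (0 < d)%R.
  by apply: le_lt_trans dl; rewrite mulr_ge0 ?divr_ge0 ?exprn_ge0// ltW.
have dm : (d <= m / 4)%R.
  apply: (le_trans dr); rewrite ler_piMr ?divr_ge0 ?(ltW m0)//.
  by have /andP[] := h2 n.+1.
have Edec : borel_energy F = crossing (EFin \o K) F +
    ((2^-1)%:E * mutual (@newton R N) F F - A%:E * nuclear F).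
  by rewrite /borel_energy addeA.
have [V [W [EV EW _ _]]] := parts F _ mF Fv.
(* If [F] has infinite perimeter its energy is infinite and there is nothing to prove; the concavity
   step needs a finite one. *)
have [PFoo|] := ltP (crossing (EFin \o K) F) +oo; last first.
  rewrite leye_eq => /eqP Py; rewrite Edec Py EV EW -!EFinM -!EFinN -!EFinD.
  by rewrite addye// ?addye// leey.
have d14 : (0 < d <= m / 4)%R by rewrite d0.
have [U [I [mU mI Um Im UI]]] := step F d mF Fv d14 PFoo.
have EU := minE _ mU Um.
have EI : borel_energy E <= borel_energy I + (C * (2 * d) `^ b)%:E.
  apply: IH => //; move: dl dr; rewrite [(2^-1 ^+ n.+2)%R]exprS [(2^-1 ^+ n.+1)%R]exprS.
  by move=> ? ?; apply/andP; split; lra.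
have PFf : crossing (EFin \o K) F \is a fin_num by rewrite ge0_fin_numE// crossing_ge0.
have [f Ef] : exists f : R, borel_energy F = f%:E.
  rewrite /borel_energy EV EW -(fineK PFf) -!EFinM -!EFinN -!EFinD.
  by eexists; reflexivity.
have := leeD EU EI; rewrite [leRHS]addeA => /le_trans/(_ (leeD2r _ UI)).
rewrite Ee Ef -!EFinD !lee_fin => key.
have E2 : ((2 * d) `^ b = 2 `^ b * d `^ b)%R by rewrite powRM// ltW.
rewrite E2 in key.
have : (C1 * d `^ b <= C * (2 - 2 `^ b) * d `^ b)%R.
  by apply: ler_wpM2r => //; exact: powR_ge0.
rewrite mulrBr mulrBl -!mulrA; lra.
Qed.

End profile.

(** * Cutting the tail *)

Section tail.
Context {R : realType} (N : nat).
Local Open Scope ereal_scope.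
Local Notation T := 'rV[R]_N.
Local Notation mu := (@borel_lebesgue R N : {measure set T -> \bar R}).
Variables (K : T -> R) (s A kappa : R).
Hypotheses (N_ge2 : (2 <= N)%N) (s01 : (0 < s < 1)%R) (A0 : (0 <= A)%R).
Hypotheses (mK : measurable_fun setT K) (K0 : forall x, (0 <= K x)%R).
Hypothesis K_even : forall x, K (- x)%R = K x.
Hypothesis K_ge : forall x, x != 0%R -> (enorm x `^ (- (N%:R + s)) <= K x)%R.
Hypotheses (kappa0 : (0 < kappa)%R) (wk : weighted_mass K <= kappa%:E).

Let mk : measurable_fun setT (EFin \o K).
Proof. exact/measurable_EFinP. Qed.

Let k0 x : 0 <= (EFin \o K) x.
Proof. by rewrite lee_fin. Qed.

Let kN x : (EFin \o K) (- x)%R = (EFin \o K) x.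
Proof. by rewrite /= K_even. Qed.

Let mB (r : R) : measurable (eball 0 r : set T).
Proof. exact: measurable_eball0. Qed.

(** Outside a ball of radius at least one, [1 / |x| <= 1], so the attraction lost with the tail is
    linear in its volume. This is why all radii start at one. *)
Lemma nuclear_cut (E : set T) (r : R) : measurable E -> (1 <= r)%R ->
  nuclear E <= nuclear (E `&` eball 0 r) + mu (E `\` eball 0 r) :> \bar R.
Proof.
move=> mE r1.
have mE1 := measurableI _ _ mE (mB r); have mE2 := measurableD mE (mB r).
have mi (D : set T) : measurable D ->
    measurable_fun setT (fun x => newton x * (\1_D x)%:E).
  move=> mD; apply: emeasurable_funM; first exact: measurable_newton.
  exact/measurable_EFinP/measurable_indic.
have i0 (D : set T) x : 0 <= newton x * (\1_D x)%:E.
  by rewrite mule_ge0 ?newton_ge0// lee_fin.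
have m2 : measurable_fun setT (fun x : T => (\1_(E `\` eball 0 r) x)%:E : \bar R).
  exact/measurable_EFinP/measurable_indic.
rewrite /nuclear -[E `\` _]setIT -(integral_indic _ measurableT mE2).
rewrite -ge0_integralD//; last exact: mi.
apply: ge0_le_integral => //; [exact: mi|by apply: emeasurable_funD => //; exact: mi|].
move=> x _; rewrite !indicE in_setD in_setI.
case: (x \in E); last by rewrite mule0 adde_ge0// mule_ge0 ?newton_ge0.
have [xr|xr] := boolP (x \in eball 0 r); first by rewrite !mule1 adde0.
rewrite mule1 mule0 add0e /newton.
have rx : (1 <= enorm x)%R.
  by apply: (le_trans r1); move: xr; rewrite notin_setE eball0E => /negP; rewrite -leNgt.
have x0 : (0 < enorm x)%R by exact: lt_le_trans rx.
by rewrite inver (negbTE (lt0r_neq0 x0)) lee_fin invf_le1.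
Qed.

Lemma tail_vanishes (E : set T) (e : R) : measurable E -> mu E < +oo -> (0 < e)%R ->
  exists2 a : R, (1 <= a)%R & mu (E `\` eball 0 a) <= e%:E.
Proof.
move=> mE Eoo e0.
pose F (n : nat) := E `\` eball 0 (n.+1%:R : R).
have mF n : measurable (F n) by exact: measurableD.
have F0 : \bigcap_n F n = set0.
  apply/seteqP; split => // x Fx.
  have [_ /=] := Fx (Num.truncn (enorm x)) I; apply.
  by rewrite eball0E truncnS_gt.
have Fni : nonincreasing_seq F.
  move=> n k nk; apply/subsetPset => x [Ex xk]; split => // xn; apply: xk.
  by move: xn; rewrite !eball0E => /lt_le_trans; apply; rewrite ler_nat ltnS.
have F0oo : mu (F 0%N) < +oo.
  by apply: le_lt_trans Eoo; apply: le_measure; rewrite ?inE//; exact: subDsetl.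
have mcap : measurable (\bigcap_n F n) by rewrite F0.
have := @nonincreasing_cvg_mu _ _ R mu F F0oo mF mcap Fni.
rewrite F0 measure0 => cvgF; apply: contrapT => none.
have : e%:E <= limn (mu \o F).
  apply: lime_ge; first by apply/cvg_ex; exists 0.
  apply: nearW => n; rewrite leNgt; apply/negP => /ltW Fe; apply: none.
  by exists n.+1%:R => //; rewrite ler1n.
by rewrite (cvg_lim _ cvgF)// lee_fin leNgt e0.
Qed.

Lemma bounded_minimizer (m : R) (E : set T) : (0 < m)%R ->
  measurable E -> mu E = m%:E -> crossing (EFin \o K) E < +oo ->
  (forall U, measurable U -> mu U = m%:E ->
    borel_energy K A E <= borel_energy K A U) ->
  exists2 r : R, (1 <= r)%R & mu (E `\` eball 0 r) = 0.
Proof.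
move=> m0 mE Em Poo minE; have /andP[s0 s1] := s01.
have NR2 : (2 <= N%:R :> R)%R by rewrite (ler_nat R 2 N).
have NR0 : (0 < N%:R :> R)%R by lra.
(* A quarter-free margin: [al = 1 - 2 * g] and [b = 1 - g] is the midpoint between [al] and one. *)
pose g : R := (s / (2 * N%:R))%R.
have g0 : (0 < g)%R by rewrite divr_gt0// mulr_gt0.
have g1 : (2 * g < 1)%R.
  rewrite /g (_ : 2 * (s / (2 * N%:R)) = s / N%:R)%R; last by field; rewrite lt0r_neq0.
  by rewrite ltr_pdivrMr// mul1r; lra.
pose b : R := (1 - g)%R.
pose al : R := (1 - s / N%:R)%R.
have alE : al = (1 - 2 * g)%R by rewrite /al /g; field; rewrite lt0r_neq0.
have al01 : (0 < al < 1)%R by rewrite alE; apply/andP; split; lra.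
have b01 : (0 < b < 1)%R by rewrite /b; apply/andP; split; lra.
have [Cp Cp0 prof] := profile_bound N_ge2 s01 A0 mK K0 K_ge b01 m0 mE Em Poo minE.
have [c c0 iso] := isoperimetric (ltnW N_ge2) s01 mK K0 K_ge.
have Eoo : mu E < +oo by rewrite Em ltry.
pose tail (r : R) := E `\` eball 0 r.
have mt r : measurable (tail r) by exact: measurableD.
have tfin r : mu (tail r) \is a fin_num.
  rewrite ge0_fin_numE//; apply: le_lt_trans Eoo.
  by apply: le_measure; rewrite ?inE//; exact: subDsetl.
pose f (r : R) : R := fine (mu (tail r)).
have fE r : mu (tail r) = (f r)%:E by rewrite /f fineK.
have f0 r : (0 <= f r)%R by rewrite fine_ge0.
have fni (x y : R) : (x <= y)%R -> (f y <= f x)%R.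
  move=> xy; rewrite -lee_fin -!fE; apply: le_measure; rewrite ?inE//.
  move=> z [Ez zy]; split => // zx; apply: zy.
  by move: zx; rewrite !eball0E => /lt_le_trans; apply.
(* The three bounds let [f r] be an admissible deficit in [prof], give [f r <= f r ^ b], and make
   the lower-order terms at most half of the isoperimetric gain. *)
pose h : R := (Num.min (Num.min (m / 4) 1) ((c / 2 / (A + Cp)) `^ g^-1))%R.
have ACp : (0 < A + Cp)%R by rewrite ltr_wpDl.
have h0 : (0 < h)%R.
  by rewrite !lt_min divr_gt0//= ltr01/= powR_gt0// !divr_gt0.
have hm : (h <= m / 4)%R by rewrite !ge_min lexx.
have h1 : (h <= 1)%R by rewrite !ge_min lexx orbT.
have hg : ((A + Cp) * h `^ g <= c / 2)%R.
  rewrite mulrC -ler_pdivlMr//.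
  have hh : (h <= (c / 2 / (A + Cp)) `^ g^-1)%R by rewrite !ge_min lexx !orbT.
  apply: (le_trans (ge0_ler_powR (ltW g0) (ltW h0) (powR_ge0 _ _) hh)).
  by rewrite -powRrM mulVf ?lt0r_neq0// powRr1// !divr_ge0// ltW.
have [a a1 fa0] : exists2 a : R, (1 <= a)%R & f a = 0%R.
  apply: (@de_giorgi R f (8 * kappa / c)%R h al) => //.
  - by rewrite divr_gt0// mulr_gt0.
  - move=> a l a1 l01 fah; have /andP[l0 l1] := l01.
    have [fl0|fl0] := eqVneq (f (a + l)%R) 0%R.
      rewrite fl0 powR0; last by have /andP[/lt0r_neq0] := al01.
      by rewrite !mulr_ge0// ?invr_ge0 ?ltW.
    have {}fl0 : (0 < f (a + l))%R by rewrite lt_def fl0 f0.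
    have fa0 : (0 < f a)%R by apply: (lt_le_trans fl0); apply: fni; rewrite lerDl ltW.
    have [r /andP[ar ra] Jr] := averaging_cut mK K0 wk kappa0 mE l01 fa0 (fE a).
    have fr0 : (0 < f r)%R by apply: (lt_le_trans fl0); exact: fni.
    have fra : (f r <= f a)%R by exact: fni.
    have r1 : (1 <= r)%R by exact: le_trans ar.
    have mE1 := measurableI _ _ mE (mB r).
    have E1v : mu (E `&` eball 0 r) = (m - f r)%:E.
      have E12 : mu E = mu (tail r) + mu (E `&` eball 0 r) by exact: measureDI.
      rewrite Em fE in E12.
      have E1f : mu (E `&` eball 0 r) \is a fin_num.
        rewrite ge0_fin_numE// (le_lt_trans _ Eoo)//.
        by apply: le_measure; rewrite ?inE//; exact: subIsetl.
      move: E12; rewrite -(fineK E1f) -EFinD => -[->]; congr EFin; ring.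
    have frm : (0 < f r <= m / 4)%R by rewrite fr0 (le_trans fra)// (le_trans fah).
    (* The truncated set has too little volume to be compared with [E] directly; the profile bound
       with deficit [f r] charges [Cp * f r ^ b] for the difference. *)
    have prof1 := prof _ _ mE1 E1v frm.
    have cut := crossing_cut mk k0 mE (mB r).
    rewrite -(mutualC mk k0 kN mE1 (mt r)) in cut.
    have iso2 := iso _ _ (mt r) fr0 (fE r).
    have ncut := nuclear_cut mE r1; rewrite -/(tail r) fE in ncut.
    have Vle : mutual (@newton R N) (E `&` eball 0 r) (E `&` eball 0 r) <=
        mutual (@newton R N) E E.
      by apply: (le_mutual (@measurable_newton R N) (@newton_ge0 R N)) => //;
        exact: subIsetl.
    have [H H0 parts] := @finite_energy_parts R N N_ge2.
    have [V [W [EV EW _ _]]] := parts _ _ mE Em.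
    have [V1 [W1 [EV1 EW1 _ _]]] := parts _ _ mE1 E1v.
    rewrite EV EV1 lee_fin in Vle.
    rewrite EW EW1 -EFinD lee_fin in ncut.
    have AW : (A * W <= A * W1 + A * f r)%R by rewrite -mulrDr; exact: ler_wpM2l.
    have J0 := mutual_ge0 k0 (E `&` eball 0 r) (tail r).
    have Jf : mutual (EFin \o K) (E `&` eball 0 r) (tail r) \is a fin_num.
      by rewrite ge0_fin_numE// (le_lt_trans Jr)// ltry.
    have Pf : crossing (EFin \o K) E \is a fin_num.
      by rewrite ge0_fin_numE// crossing_ge0.
    rewrite -/(tail r) -(fineK Jf) lee_fin in Jr.
    rewrite -/(tail r) -(fineK Pf) -(fineK Jf) -!EFinD in cut.
    have P12 : crossing (EFin \o K) (E `&` eball 0 r) +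
        crossing (EFin \o K) (tail r) < +oo by rewrite -cut ltry.
    have P1f : crossing (EFin \o K) (E `&` eball 0 r) \is a fin_num.
      rewrite ge0_fin_numE ?crossing_ge0//.
      by apply: (le_lt_trans _ P12); rewrite leeDl// crossing_ge0.
    have P2f : crossing (EFin \o K) (tail r) \is a fin_num.
      rewrite ge0_fin_numE ?crossing_ge0//.
      by apply: (le_lt_trans _ P12); rewrite leeDr// crossing_ge0.
    rewrite -(fineK P1f) -(fineK P2f) -EFinD in cut; case: cut => cut.
    rewrite -(fineK P2f) lee_fin -/al in iso2.
    rewrite /borel_energy EV EV1 EW EW1 -(fineK Pf) -(fineK P1f) in prof1.
    rewrite -!EFinM -!EFinN -!EFinD lee_fin in prof1.
    (* The perimeter of [E] cancels between [prof1] and [cut], leaving that of the tail against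
       twice the interaction; truncation does not increase the repulsion, and the attraction lost is
       at most [f r]. *)
    have {prof1 cut Vle ncut AW}main : (c * f r `^ al <=
        2 * (2 * kappa * f a / l) + (A * f r + Cp * f r `^ b))%R.
      by lra.
    have absorb : (A * f r + Cp * f r `^ b <= c / 2 * f r `^ al)%R.
      apply: (@le_trans _ _ ((A + Cp) * f r `^ b)%R).
        rewrite mulrDl lerD2r; apply: ler_wpM2l => //.
        rewrite -[leLHS](powRr1 (ltW fr0)); apply: ger_powR.
          by rewrite fr0 (le_trans fra)// (le_trans fah).
        by rewrite /b gerBl ltW.
      have -> : b = (g + al)%R by rewrite alE /b; ring.
      rewrite powRD; last by rewrite (lt0r_neq0 fr0) implybT.
      rewrite mulrA; apply: ler_wpM2r; first exact: powR_ge0.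
      apply: le_trans hg; apply: ler_wpM2l; first exact: ltW.
      by apply: (ge0_ler_powR (ltW g0) (f0 r) (ltW h0)); exact: le_trans fah.
    have al0 : (0 <= al)%R by have /andP[/ltW] := al01.
    apply: (@le_trans _ _ (f r `^ al)%R).
      by apply: (ge0_ler_powR al0 (f0 _) (f0 _)); exact: fni.
    rewrite -(ler_pM2l c0).
    have -> : (c * (8 * kappa / c / l * f a) = 4 * (2 * kappa * f a / l))%R.
      by field; rewrite !lt0r_neq0.
    by lra.
  - move=> e e0; have [a a1 ae] := tail_vanishes mE Eoo e0.
    by exists a => //; rewrite -lee_fin -fE.
by exists a => //; rewrite -/(tail a) fE fa0.
Qed.

End tail.

(** * Passage from a Lebesgue measurable minimizer to its Borel hull *)

Theorem lemma2p1 (R : realType) (N : nat) (A m : R) (K : 'rV[R]_N -> R)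
    (hN : (2 <= N)%N) (hA : 0 <= A) (hm : 0 < m)
    (K_ge0 : forall x, 0 <= K x)
    (K_even : forall x, K (- x) = K x)
    (K_L1 : lebesgue_rV.-integrable (~` eball 0 1) (EFin \o K))
    (K_lip : [locally [lipschitz (K x : R^o) | x in [set x | x != 0]]])
    (K_bounds : exists s eps lambda : R,
      [/\ 0 < s < 1,
          0 < 2 `^ (N%:R + s - 1)^-1 - 1 < eps,
          1 < lambda,
          forall x, 0 < enorm x < 1 + eps ->
            enorm x `^ (- (N%:R + s)) <= K x
              <= lambda * enorm x `^ (- (N%:R + s)) &
          forall x, 1 + eps <= enorm x ->
            enorm x `^ (- (N%:R + s)) <= K x
              <= (1 + eps) `^ (- (N%:R + s))])
    (E : set 'rV[R]_N) (hE : minimizer K A m E) :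
  exists2 r : R, 0 < r & lebesgue_rV (E `\` eball 0 r) = 0%E.
Proof.
have [s [eps [lambda [s01 /andP[e0 e1] l1 Knear Kfar]]]] := K_bounds.
have eps0 : 0 < eps by exact: lt_trans e1.
have lambda0 : 0 < lambda by exact: lt_trans l1.
have N0 : (0 < N)%N by exact: ltnW.
have mK := locally_lipschitz_measurable K_lip.
have K_ge x : x != 0 -> enorm x `^ (- (N%:R + s)) <= K x.
  move=> x0; have [xe|xe] := ltP (enorm x) (1 + eps).
    have /Knear/andP[]// : 0 < enorm x < 1 + eps by rewrite enorm_gt0 x0.
  by have /andP[] := Kfar x xe.
have K_le x : 0 < enorm x < 1 -> K x <= lambda * enorm x `^ (- (N%:R + s)).
  move=> /andP[x0 x1].
  have /Knear/andP[]// : 0 < enorm x < 1 + eps by rewrite x0 (lt_trans x1)// ltrDl.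
have k0 x : (0 <= (EFin \o K) x)%E by rewrite lee_fin.
have Koo : (\int[leb N]_x ((K x)%:E * (\1_(~` eball 0 1) x)%:E) < +oo)%E.
  have mD : measurable (~` eball 0 1 : set 'rV[R]_N).
    by apply: measurableC; exact: measurable_eball0.
  have mkE : measurable_fun setT (EFin \o K) by exact/measurable_EFinP.
  rewrite -(integral_indicator mD mkE k0).
  have /integrableP[_] := K_L1.
  by under eq_integral do rewrite gee0_abs ?lee_fin//.
have wfin := weighted_mass_finite N0 s01 mK K_ge0 lambda0 K_le Koo.
have w0 : (0 <= weighted_mass K)%E.
  by apply: integral_ge0 => z _; rewrite lee_fin mulr_ge0// le_min enorm_ge0 ler01.
pose kappa := fine (weighted_mass K) + 1.
have kappa0 : 0 < kappa by rewrite ltr_wpDl// fine_ge0.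
have wk : (weighted_mass K <= kappa%:E)%E.
  by rewrite -[leLHS]fineK ?ge0_fin_numE// lee_fin lerDl.
have [mE Em minE] := hE.
have energyB U : measurable U -> energy K A U = borel_energy K A U.
  move=> mU; apply: energy_hull => //; first exact: lebesgue_measurable_borel.
  by rewrite setDv measure0.
have [B [mB EB] Bm] : exists2 B : set 'rV[R]_N, measurable B /\ E `<=` B &
    leb N B = lebesgue_rV E.
  by apply: borel_hull; rewrite Em ltry.
rewrite Em in Bm.
have mBc := lebesgue_measurable_borel mB.
have BE0 : lebesgue_rV (B `\` E) = 0%E.
  have -> : lebesgue_rV (B `\` E) = (lebesgue_rV B - lebesgue_rV (B `&` E))%E.
    apply: measureD => //; rewrite -[X in (X < _)%E]/(lebesgue_rV B).
    by rewrite lebesgue_rV_borel// Bm ltry.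
  by rewrite setIidr// lebesgue_rV_borel// Bm Em subee.
have EBe : energy K A E = borel_energy K A B.
  exact: energy_hull mE mB EB BE0.
(* Minimality among Lebesgue measurable sets restricts to Borel competitors, and the hull inherits
   it because its energy is that of [E]. *)
have minB U : measurable U -> leb N U = m%:E ->
    (borel_energy K A B <= borel_energy K A U)%E.
  move=> mU Um; rewrite -EBe -energyB//; apply: minE.
    exact: lebesgue_measurable_borel.
  by rewrite lebesgue_rV_borel.
have [H H0 parts] := @finite_energy_parts R N hN.
(* A cube of volume [m] has finite energy, so the minimal energy is not [+oo]; as the other two
   terms of the hull are finite, so is its perimeter. *)
have PB : (crossing (EFin \o K) B < +oo)%E.
  pose a := m `^ N%:R^-1 / 2.
  have a0 : 0 < a by rewrite divr_gt0// powR_gt0.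
  have aN : (2 * a) ^+ N = m.
    rewrite /a mulrCA mulfV ?mulr1// -powR_mulrn ?powR_ge0// -powRrM.
    by rewrite mulVf ?powRr1 ?(ltW hm)// pnatr_eq0 -lt0n.
  pose Q := @cube R N a.
  have mQ : measurable Q by exact: measurable_cube.
  have Qm : leb N Q = m%:E by rewrite borel_lebesgue_cube ?aN// ltW.
  have [C C0 QC] := @cube_leaving R N a a0.
  have PQ : (crossing (EFin \o K) Q < +oo)%E.
    apply: (le_lt_trans (crossing_lipschitz mK K_ge0 mQ C0 QC)).
    by rewrite lte_mul_pinfty// lee_fin.
  have [V [W [EV EW _ _]]] := parts _ _ mB Bm.
  have [V' [W' [EV' EW' _ _]]] := parts _ _ mQ Qm.
  have := minB Q mQ Qm; rewrite /borel_energy EV EW EV' EW'.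
  rewrite ltNge leye_eq; apply: contraTN => /eqP ->.
  rewrite -ltNge -!EFinM -!EFinN !addye//.
  by rewrite -addeA -EFinD lte_add_pinfty// ltry.
have [r r1 Br] := bounded_minimizer hN s01 hA mK K_ge0 K_even K_ge kappa0 wk hm mB Bm PB minB.
exists r; first exact: lt_le_trans r1.
have mBr : measurable (B `\` eball 0 r).
  by apply: measurableD => //; exact: measurable_eball0.
apply/eqP; rewrite eq_le outer_measure_ge0 andbT.
rewrite -Br -(lebesgue_rV_borel mBr); apply: le_outer_measure.
exact: setSD.
Qed.
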